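(* Let $(X,\mathsf d)$ and $\mathsf E:X\to\mathbb R\cup\{+\infty\}$ satisfy the standing assumptions (A1)–(A3) and Assumption (S), and let $x,y\in X$ be such that for some (hence for every) $\varepsilon>0$ the $\varepsilon$-Schrödinger problem between $x$ and $y$ is solvable. Assume that there exists $\omega^0\in\Lambda_0(x,y)$ with $\mathcal I(\omega^0)<\infty$. Then the map $\varepsilon\mapsto\mathscr C_\varepsilon(x,y)$ is right differentiable also at $\varepsilon=0$ with $$\frac{d^+}{d\varepsilon}\mathscr C_\varepsilon(x,y)\Big|_{\varepsilon=0}=0,$$ the right derivative is right continuous at every $\varepsilon\ge0$, and, as $\varepsilon\downarrow 0$, $$\mathscr C_\varepsilon(x,y)-\mathscr C_0(x,y)=\varepsilon^2\inf_{\Lambda_0(x,y)}\mathcal I+o(\varepsilon^2).$$ Moreover, for any $\varepsilon_n\downarrow0$ and any minimizers $\omega^n\in\Lambda_{\varepsilon_n}(x,y)$ there exists $\omega^*\in\Lambda_0(x,y)$ such that, up to a subsequence, $\omega^n\to\omega^*$ in the pointwise-in-time $\sigma$-topology, and $\omega^*$ has minimal Fisher information in $\Lambda_0(x,y)$, i.e. $$\mathcal I(\omega^* )=\min_{\Lambda_0(x,y)}\mathcal I.$$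
   Context: Curves: for a metric space $(X,\mathsf d)$, $C([0,1],X)$ denotes the continuous curves $\gamma=(\gamma_t)_{t\in[0,1]}$, $|\dot\gamma_t|$ the metric speed of an absolutely continuous curve, and $AC^2([0,1],X)$ the absolutely continuous curves with $|\dot\gamma|\in L^2(0,1)$. Slope: $D(\mathsf E)=\{x\in X:\mathsf E(x)<\infty\}$. The slope $|\partial\mathsf E|(x)$ is $+\infty$ if $x\notin D(\mathsf E)$, $0$ if $x$ is isolated, and $|\partial\mathsf E|(x)=\limsup_{z\to x}\frac{[\mathsf E(x)-\mathsf E(z)]^+}{\mathsf d(x,z)}$ otherwise. $\mathrm{EVI}_\lambda$-gradient flow of $\mathsf E$ ($\lambda\in\mathbb R$) starting from $x$: a curve $(\gamma_t)_{t>0}$ in $AC_{loc}((0,\infty),X)$ with $\gamma_t\to x$ as $t\downarrow0$ and $\frac12\frac{d}{dt}\mathsf d^2(\gamma_t,z)+\frac\lambda2\mathsf d^2(\gamma_t,z)+\mathsf E(\gamma_t)\le\mathsf E(z)$ for all $z\in X$ and a.e. $t>0$. Standing assumptions: (A1) $(X,\mathsf d)$ is a complete separable metric space. (A2) $\mathsf E$ is lower semicontinuous, $\overline{D(\mathsf E)}=X$, and for every $\mathsf d$-bounded $B\subset X$ there is $c_B\in\mathbb R$ with $\mathsf E\ge c_B$ on $B$. (A3) There is $\lambda\in\mathbb R$ such that for every $x\in X$ there exists an $\mathrm{EVI}_\lambda$-gradient flow of $\mathsf E$ starting from $x$. Assumption (S): there is a Hausdorff topology $\sigma$ on $X$ such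 that every $\mathsf d$-bounded sequence has a $\sigma$-converging subsequence, and $\mathsf d$ (jointly in its two variables) and $|\partial\mathsf E|$ are sequentially $\sigma$-lower semicontinuous. Convergence in the pointwise-in-time $\sigma$-topology means $\omega^n_t\to\omega_t$ in $\sigma$ for every $t\in[0,1]$. Functionals on $C([0,1],X)$: $\mathcal A(\gamma)=\frac12\int_0^1|\dot\gamma_t|^2dt$ (equal to $+\infty$ if $\gamma$ is not absolutely continuous), $\mathcal I(\gamma)=\frac12\int_0^1|\partial\mathsf E|^2(\gamma_t)dt$ (the Fisher information), $\mathcal A_\varepsilon=\mathcal A+\varepsilon^2\mathcal I$ for $\varepsilon>0$ and $\mathcal A_0=\mathcal A$. Cost and minimizers, for $\varepsilon\ge0$: $\mathscr C_\varepsilon(x,y)=\inf\{\mathcal A_\varepsilon(\gamma):\gamma\in C([0,1],X),\ \gamma_0=x,\ \gamma_1=y\}$ and $\Lambda_\varepsilon(x,y)=\{\omega\in AC^2([0,1],X):\omega_0=x,\ \omega_1=y,\ \mathcal A_\varepsilon(\omega)=\mathscr C_\varepsilon(x,y)\}$. The $\varepsilon$-Schrödinger problem between $x$ and $y$ ($\varepsilon>0$) is solvable if this infimum is finite and attained. Under these assumptions the right derivative of $\varepsilon\mapsto\mathscr C_\varepsilon(x,y)$ exists at every $\varepsilon>0$. *)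

(* Defs.v *)
From HB Require Import structures.
From mathcomp Require Import all_boot all_order all_algebra.
From mathcomp Require Import all_classical all_reals all_analysis.
Set Implicit Arguments.
Unset Strict Implicit.
Unset Printing Implicit Defensive.
Import Order.TTheory GRing.Theory Num.Theory.
Import numFieldNormedType.Exports.
Local Open Scope classical_set_scope.
Local Open Scope ring_scope.

(* A topology on a type which may already carry another one, given by its open
   sets. [tspace s] is [T] seen as a topological space for [s], so that the
   library notions (convergence, Hausdorff) apply to [s]. *)
Record topology_on (T : Type) := TopologyOn {
  topen : set (set T) ;
  topenT : topen setT ;
  topenI : forall A B : set T, topen A -> topen B -> topen (A `&` B) ;
  topen_bigU : forall (I : Type) (f : I -> set T),
    (forall i, topen (f i)) -> topen (\bigcup_i f i)
}.

Definition tspace (T : choiceType) (s : topology_on T) : Type := T.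

HB.instance Definition _ (T : choiceType) (s : topology_on T) :=
  Choice.on (tspace s).
HB.instance Definition _ (T : choiceType) (s : topology_on T) :=
  isOpenTopological.Build (tspace s)
    (@topenT T s) (@topenI T s) (@topen_bigU T s).

Definition cvg_in (T : choiceType) (s : topology_on T) (u : nat -> T) (l : T) :=
  ((u : nat -> tspace s) n @[n --> \oo] --> (l : tspace s)).

Section metric.
Context {R : realType} {X : metricType R}.
Implicit Types (E : X -> \bar R) (g w : R -> X) (x y z : X).
Local Notation mu := (@lebesgue_measure R).

Definition complete_metric := forall u : nat -> X,
  cauchy (u n @[n --> \oo]) -> exists l : X, u n @[n --> \oo] --> l.

Definition separable_space := exists2 S : set X, countable S & dense S.

Definition metric_bounded (B : set X) :=
  exists M : R, forall x y, B x -> B y -> mdist x y <= M.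

(* A curve is a total function on [R]; only its values on the relevant interval
   matter. *)
Definition abs_cont (a b : R) g := exists2 f : R -> R,
  mu.-integrable `[a, b] (EFin \o f) &
  forall s t, a <= s -> s <= t -> t <= b ->
    ((mdist (g s) (g t))%:E <= \int[mu]_(r in `[s, t]) (f r)%:E)%E.

(* For an absolutely continuous curve this limit exists almost everywhere. *)
Definition metric_speed g (t : R) : R :=
  lim (mdist (g t) (g s) / `|s - t| @[s --> t^']).

Definition AC2 g := abs_cont 0 1 g /\
  (\int[mu]_(t in `[0%R, 1%R]) (metric_speed g t ^+ 2)%:E < +oo)%E.

Definition edom E : set X := [set x | (E x < +oo)%E].

Definition slope E x : \bar R :=
  if ~~ (E x < +oo)%E then +oo%E
  else if `[< isolated setT x >] then 0%E
  else limf_esup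
         (fun z => maxe (E x - E z)%E 0%E * ((mdist x z)^-1)%:E)%E x^'.

Definition EVI_flow (lambda : R) E x g :=
  [/\ forall a b, 0 < a -> a <= b -> abs_cont a b g,
      g t @[t --> 0^'+] --> x &
      forall z, {ae mu, forall t, 0 < t ->
        derivable (fun s => mdist (g s) z ^+ 2) t 1 /\
        ((2^-1 * derive1 (fun s => mdist (g s) z ^+ 2) t
          + lambda / 2 * mdist (g t) z ^+ 2)%:E + E (g t) <= E z)%E}].

Definition assumption_A1 := complete_metric /\ separable_space.

Definition assumption_A2 E :=
  [/\ lower_semicontinuous E,
      closure (edom E) = setT &
      forall B, metric_bounded B ->
        exists c : R, forall x, B x -> (c%:E <= E x)%E].

Definition assumption_A3 E :=
  exists lambda : R, forall x, exists g, EVI_flow lambda E x g.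

Definition assumption_S E (sigma : topology_on X) :=
  [/\ hausdorff_space (tspace sigma),
      forall u : nat -> X, metric_bounded (range u) ->
        exists phi : nat -> nat, exists l : X,
          increasing_seq phi /\ cvg_in sigma (u \o phi) l,
      forall (u v : nat -> X) x y, cvg_in sigma u x -> cvg_in sigma v y ->
        ((mdist x y)%:E <= limn_einf (fun n => (mdist (u n) (v n))%:E))%E &
      forall (u : nat -> X) x, cvg_in sigma u x ->
        (slope E x <= limn_einf (fun n => slope E (u n)))%E].

Definition action g : \bar R :=
  if `[< abs_cont 0 1 g >] then
    ((2^-1)%:E * \int[mu]_(t in `[0%R, 1%R]) (metric_speed g t ^+ 2)%:E)%E
  else +oo%E.

Definition fisher E g : \bar R :=
  ((2^-1)%:E * \int[mu]_(t in `[0%R, 1%R]) (slope E (g t) ^+ 2))%E.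

(* Since [0 * +oo = 0] in [\bar R], the case [eps = 0] is [action]. *)
Definition action_eps E (eps : R) g : \bar R :=
  (action g + (eps ^+ 2)%:E * fisher E g)%E.

Lemma action_eps0 E g : action_eps E 0 g = action g.
Proof. by rewrite /action_eps expr0n /= mul0e adde0. Qed.

Definition curves x y : set (R -> X) :=
  [set g : R -> X | [/\ {within `[0%R, 1%R], continuous g}, g 0 = x & g 1 = y]].

Definition cost E (eps : R) x y : \bar R :=
  ereal_inf [set action_eps E eps g | g in curves x y].

Definition minimizers E (eps : R) x y : set (R -> X) :=
  [set w | [/\ AC2 w, w 0 = x, w 1 = y & action_eps E eps w = cost E eps x y]].

Definition schrodinger_solvable E (eps : R) x y :=
  cost E eps x y \is a fin_num /\
  exists2 g, curves x y g & action_eps E eps g = cost E eps x y.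

End metric.

Arguments complete_metric {R} X.
Arguments separable_space {R} X.
Arguments assumption_A1 {R} X.

Section right_derivative.
Context {R : realType}.
Implicit Types (f : R -> R) (a : R).

Definition right_quotient f a (h : R) : R := h^-1 * (f (a + h) - f a).

Definition right_derivable f a := cvg (right_quotient f a h @[h --> 0^'+]).

Definition right_derive f a : R := lim (right_quotient f a h @[h --> 0^'+]).

End right_derivative.

(* Main.v *)
From HB Require Import structures.
From mathcomp Require Import all_boot all_order all_algebra.
From mathcomp Require Import all_classical all_reals all_analysis.
From mathcomp Require Import measurable_realfun ring lra.
Require Import Defs.
Set Implicit Arguments.
Unset Strict Implicit.
Unset Printing Implicit Defensive.
Import Order.TTheory GRing.Theory Num.Theory.
Import numFieldNormedType.Exports.
Local Open Scope classical_set_scope.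
Local Open Scope ring_scope.

(** Write [A] for the action, [I] for the Fisher information, [C eps] for the
    cost and [Lambda_0] for the set of minimizers of the action.

    As an infimum of the affine functions [s |-> A + s * I], the function
    [G s = C (sqrt s)] is concave and nondecreasing on the half line. It is
    Lipschitz there, because a curve of [Lambda_0] with finite Fisher
    information [L] gives [G s <= G 0 + s * L]. So [G] has a right derivative
    [D] at every point of the half line, the origin included, and [D] is right
    continuous ([right_slope_cvg], [right_slope_right_continuous]). Since
    [C eps = G (eps ^+ 2)], the right derivative of [C] at [eps] is
    [2 * eps * D (eps ^+ 2)], which vanishes at [eps = 0], and
    [C eps - C 0 = eps ^+ 2 * D 0 + o(eps ^+ 2)].

    It remains to see that [m = D 0] is the minimum of [I] over [Lambda_0]. A
    curve of [Lambda_0] belongs to the competitors that define [G], so its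
    Fisher information bounds the slope of [G] at [0] ([m_le_fisher]).
    Conversely, when [s_n] tends to [0], a curve that minimizes [A + s_n * I]
    up to [s_n ^+ 2] has action at most [G 0 + o(1)] and Fisher information at
    most [m + o(1)], and a limit of such curves lies in [Lambda_0] with
    [I <= m] ([energy_limit]). The same lemma, applied to exact minimizers,
    gives the last claim of the theorem.

    The compactness behind this ([curve_compactness]) has three parts.
    - Curves of bounded action are equicontinuous, so a diagonal extraction at
      the rational times and the lower semicontinuity of the distance for
      [sigma] give convergence at every time ([limit_curve]).
    - The Fisher information passes to the limit by Fatou's lemma. The slope is
      lower semicontinuous for the distance too, hence Borel along curves,
      because a sequence converging for the distance has a subsequence
      converging for [sigma], with the same limit ([slope_lsc], [fisher_lsc]).
    - The action is lower semicontinuous ([action_lsc]). In place of a weak L2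
      limit of the metric speeds, consider the convex set [K n] of the
      functions [h] whose integral over any [[s, t]] dominates the infimum over
      [k >= n] of the distances from [gam k s] to [gam k t]. These sets decrease
      with [n], and elements of almost minimal norm converge strongly, by the
      parallelogram identity ([minimal_norm_limit]). Their limit dominates the
      speed of the limit curve.

    All of this uses that an absolutely continuous curve has a metric speed
    almost everywhere, and that the distance between two of its points is at
    most the integral of the speed ([metric_derivative]). The distances to
    countably many points of the curve are real functions dominated by the
    primitive of an integrable function. By the Radon-Nikodym theorem they are
    primitives ([dominated_primitive]), and by Lebesgue's differentiation
    theorem the supremum of the absolute values of their derivatives is the
    metric speed. *)

(** * Primitives of integrable functions and Lebesgue points *)

Section primitive.
Context {R : realType}.
Local Notation mu := (@lebesgue_measure R).
Implicit Types (f g : R -> R).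

(** Increments of this function are integrals over intervals, and bounds between
    such increments are easier to combine than bounds between integrals. The
    interval is unbounded below so that no base point has to be chosen. *)
Definition primitive f (t : R) : R := \int[mu]_(r in `]-oo, t]) f r.

Lemma integrable_in f (A : set R) : measurable A ->
  mu.-integrable setT (EFin \o f) -> mu.-integrable A (EFin \o f).
Proof. by move=> mA; apply: integrableS. Qed.

Lemma integrable_measurable_fun f (A : set R) :
  mu.-integrable A (EFin \o f) -> measurable_fun A f.
Proof. by move=> /integrableP[/measurable_EFinP]. Qed.

Lemma primitiveB f s t : mu.-integrable setT (EFin \o f) -> s <= t ->
  primitive f t - primitive f s = \int[mu]_(r in `]s, t]) f r.
Proof.
move=> intf st; by apply: Rintegral_itvB => //; exact: integrable_in.
Qed.

Lemma primitiveB_cc f s t : mu.-integrable setT (EFin \o f) -> s <= t ->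
  primitive f t - primitive f s = \int[mu]_(r in `[s, t]) f r.
Proof.
move=> intf st; rewrite primitiveB// Rintegral_itv_obnd_cbnd//.
exact: integrable_in.
Qed.

Lemma primitiveB_ccE f s t : mu.-integrable setT (EFin \o f) -> s <= t ->
  (primitive f t - primitive f s)%:E = (\int[mu]_(r in `[s, t]) (f r)%:E)%E.
Proof.
move=> intf st; rewrite primitiveB_cc// /Rintegral fineK//.
by apply: integrable_fin_num => //; apply: integrable_in.
Qed.

Lemma primitiveB_ocE f s t : mu.-integrable setT (EFin \o f) -> s <= t ->
  (primitive f t - primitive f s)%:E = (\int[mu]_(r in `]s, t]) (f r)%:E)%E.
Proof.
move=> intf st; rewrite primitiveB// /Rintegral fineK//.
by apply: integrable_fin_num => //; apply: integrable_in.
Qed.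

Lemma primitive_nd f : mu.-integrable setT (EFin \o f) -> (forall r, 0 <= f r) ->
  {homo primitive f : s t / s <= t}.
Proof.
move=> intf f0 s t st; rewrite -subr_ge0 primitiveB//.
by apply: Rintegral_ge0.
Qed.

Lemma primitive_continuous f : mu.-integrable setT (EFin \o f) ->
  continuous (primitive f).
Proof.
move=> intf t; apply/(@cvgrPdist_lt _ R) => e e0.
have [d [d0 dP]] := integral_normr_continuous intf e0.
have key s u : s <= u -> u - s < d -> `|primitive f u - primitive f s| < e.
  move=> su usd; rewrite primitiveB//.
  apply: le_lt_trans (dP `]s, u]%classic _ _) => //.
    apply: le_normr_Rintegral => //; exact: integrable_in.
  by rewrite /= lebesgue_measure_itv/=; case: ifP => // _; rewrite -EFinB lte_fin.
near=> s.
have ds : `|t - s| < d by near: s; apply: (@cvgr_dist_lt _ R) => //; apply: cvg_id.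
have [st|/ltW ts] := leP s t.
  by apply: key => //; rewrite (le_lt_trans _ ds)// ler_norm.
rewrite distrC; apply: key => //.
by rewrite (le_lt_trans _ ds)// distrC ler_norm.
Unshelve. all: by end_near. Qed.

(** Differentiability at [t] with derivative [l], in a form that does not divide
    by [s - t]: two-sided estimates can then be added and compared directly. *)
Definition linear_approx (F : R -> R) (t l : R) := forall e, 0 < e ->
  \forall s \near t, `|F s - F t - l * (s - t)| <= e * `|s - t|.

Lemma derive1_linear_approx (F : R -> R) (t l : R) :
  derivable F t 1 -> derive1 F t = l -> linear_approx F t l.
Proof.
move=> dF Fl e e0.
have : (fun h => h^-1 *: (F (h + t) - F t)) @ 0^' --> l.
  have eqq : (fun h => h^-1 *: (F (h + t) - F t)) =
      (fun h => h^-1 *: ((F \o shift t) (h *: 1) - F t)).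
    by apply/funext => h; rewrite /= [in RHS]/GRing.scale /= mulr1.
  rewrite -Fl /derive1 eqq; exact: dF.
move=> /(@cvgrPdist_le _ R) /(_ _ e0).
rewrite near_withinE => -[/= d d0 dP].
exists d => //= s /= tsd.
have [->|st] := eqVneq s t; first by rewrite !subrr mulr0 subr0 normr0 mulr0.
have st0 : s - t != 0 by rewrite subr_eq0.
have := dP (s - t); rewrite /= sub0r normrN distrC => /(_ tsd st0).
rewrite subrK => H.
have -> : F s - F t - l * (s - t) =
    - ((l - (s - t)^-1 *: (F s - F t)) * (s - t)).
  by rewrite mulrBl opprB /GRing.scale/= mulrAC mulVf// mul1r.
by rewrite normrN normrM (distrC t s) ler_wpM2r.
Qed.

Lemma primitive_ae_approx f : mu.-integrable setT (EFin \o f) ->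
  {ae mu, forall t, linear_approx (primitive f) t (f t)}.
Proof.
move=> intf.
have locf : locally_integrable setT f.
  by apply: open_integrable_locally => //; exact: openT.
have := FTC1Ny (fun y => integrable_in (measurable_itv `]-oo, y]) intf) locf.
apply: filterS; first exact: (ae_filter_ringOfSetsType mu).
by move=> t [dF Ft]; exact: derive1_linear_approx.
Qed.

End primitive.

(** * Functions dominated by a primitive are primitives *)

Section density_measure.
Context {R : realType}.
Local Notation mu := (@lebesgue_measure R).
Variable f : R -> R.
Hypotheses (mf : measurable_fun setT f) (f0 : forall r, 0 <= f r).

Definition density_measure (A : set (measurableTypeR R)) : \bar R :=
  (\int[mu]_(r in A) (f r)%:E)%E.

Let density0 : density_measure set0 = 0%E.
Proof. by rewrite /density_measure integral_set0. Qed.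

Let density_ge0 A : (0 <= density_measure A)%E.
Proof. by apply: integral_ge0 => r _; rewrite lee_fin. Qed.

Let density_sigma_additive : semi_sigma_additive density_measure.
Proof.
apply: semi_sigma_additive_nng_induced; first exact/measurable_EFinP.
by move=> r; rewrite lee_fin.
Qed.

HB.instance Definition _ := isMeasure.Build _ _ _ density_measure
  density0 density_ge0 density_sigma_additive.

Definition measure_with_density : {measure set (measurableTypeR R) -> \bar R} :=
  density_measure.

End density_measure.

Section cumulative_of.
Context {R : realType}.
Variable h : R -> R.
Hypotheses (nd : {homo h : s t / s <= t}) (ch : continuous h).

(** A copy of [h] that carries the proofs of monotonicity and continuity, so that
    a Lebesgue-Stieltjes measure can be attached to a function met in a proof. *)
Definition cumul : R -> R := h.

HB.instance Definition _ := isCumulative.Build R _ R cumul nd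
  (right_continuousW ch).

Definition cumulative_of : cumulative R R := cumul.

Lemma stieltjes_itvoc a b : a <= b ->
  lebesgue_stieltjes_measure cumulative_of `]a, b]%classic = (h b - h a)%:E.
Proof.
move=> ab; rewrite /lebesgue_stieltjes_measure /measure_extension/=.
by rewrite measurable_mu_extE/= ?wlength_itv_bnd//; exact: is_ocitv.
Qed.

End cumulative_of.

Section density.
Context {R : realType}.
Local Notation mu := (@lebesgue_measure R).

(** With [F] the primitive of [f], both [F + phi] and [F - phi] are
    nondecreasing, and their Stieltjes measures add up to the measure of density
    [2 f]. So the measure of [F + phi] is absolutely continuous, with an
    integrable density by the Radon-Nikodym theorem; subtracting [f] gives the
    density of [phi]. *)
Lemma dominated_primitive (phi f : R -> R) :
  mu.-integrable setT (EFin \o f) -> (forall r, 0 <= f r) ->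
  (forall s t, s <= t -> `|phi t - phi s| <= primitive f t - primitive f s) ->
  exists2 g : R -> R, mu.-integrable setT (EFin \o g) &
    forall s t, phi t - phi s = primitive g t - primitive g s.
Proof.
move=> intf f0 phif; set F := primitive f.
have mf : measurable_fun setT f by exact: integrable_measurable_fun intf.
have cF : continuous F by exact: primitive_continuous.
have cphi : continuous phi.
  move=> t; apply/(@cvgrPdist_le _ R) => e e0.
  have /(@cvgrPdist_le _ R) /(_ _ e0) := cF t.
  apply: filterS => s; apply: le_trans.
  have [st|/ltW ts] := leP s t; first by rewrite (le_trans (phif _ _ st))// ler_norm.
  by rewrite distrC (distrC (F t)) (le_trans (phif _ _ ts))// ler_norm.
have nd1 : {homo (fun t => F t + phi t) : s t / s <= t}.
  move=> s t /phif; rewrite ler_norml => /andP[+ _]; rewrite -/F; lra.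
have nd2 : {homo (fun t => F t - phi t) : s t / s <= t}.
  move=> s t /phif; rewrite ler_norml => /andP[_ +]; rewrite -/F; lra.
have nd3 : {homo (fun t => F t + F t) : s t / s <= t}.
  by move=> s t /(primitive_nd intf f0); rewrite -/F; lra.
have c1 : continuous (fun t => F t + phi t).
  by move=> t; apply: (@cvgD _ R); [exact: cF|exact: cphi].
have c2 : continuous (fun t => F t - phi t).
  by move=> t; apply: (@cvgB _ R); [exact: cF|exact: cphi].
have c3 : continuous (fun t => F t + F t).
  by move=> t; apply: (@cvgD _ R); exact: cF.
pose nu := lebesgue_stieltjes_measure (cumulative_of nd1 c1).
pose nu2 := lebesgue_stieltjes_measure (cumulative_of nd2 c2).
pose nu3 := lebesgue_stieltjes_measure (cumulative_of nd3 c3).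
have m2f : measurable_fun setT (fun r => f r + f r) by exact: measurable_funD.
have f20 r : 0 <= f r + f r by rewrite addr_ge0.
have int2f : mu.-integrable setT (EFin \o (fun r => f r + f r)).
  have -> : EFin \o (fun r => f r + f r) = ((EFin \o f) \+ (EFin \o f))%E.
    by [].
  exact: integrableD.
have E1 A : measurable A -> nu3 A = (\int[mu]_(r in A) (f r + f r)%:E)%E.
  apply: (lebesgue_stieltjes_measure_unique
    (mu := measure_with_density m2f f20)) => _ [[a b] _ <-] /=.
  have [ab|ba] := leP a b; last first.
    rewrite set_itv_ge ?bnd_simp -?leNgt ?ltW//.
    by rewrite measure0 [RHS]measure0.
  rewrite stieltjes_itvoc//= /density_measure.
  transitivity ((F b - F a)%:E + (F b - F a)%:E)%E.
    by rewrite -EFinD; congr EFin; ring.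
  rewrite primitiveB_ocE// -ge0_integralD//.
  - by move=> r _; rewrite lee_fin.
  - by apply/measurable_EFinP; exact: measurable_funTS.
  - by move=> r _; rewrite lee_fin.
  - by apply/measurable_EFinP; exact: measurable_funTS.
have E2 A : measurable A -> nu3 A = (nu A + nu2 A)%E.
  move=> mA; rewrite -(measure_addE nu nu2); move: A mA.
  apply: (lebesgue_stieltjes_measure_unique
    (mu := measure_add nu nu2)) => _ [[a b] _ <-].
  rewrite [RHS](measure_addE nu nu2).
  have [ab|ba] := leP a b; last first.
    rewrite set_itv_ge ?bnd_simp -?leNgt ?ltW//.
    by rewrite !measure0 adde0.
  rewrite (stieltjes_itvoc nd3 c3 ab).
  transitivity ((F b + phi b - (F a + phi a))%:E + (F b - phi b - (F a - phi a))%:E)%E.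
    by rewrite -EFinD; congr EFin; ring.
  by congr (_ + _)%E; apply/esym/stieltjes_itvoc.
have le2 A : measurable A -> (nu A <= \int[mu]_(r in A) (f r + f r)%:E)%E.
  by move=> mA; rewrite -E1// E2// leeDl.
have fin : fin_num_fun nu.
  move=> A mA; rewrite ge0_fin_numE//; apply: le_lt_trans (le2 _ mA) _.
  have /integrableP[_] := integrable_in mA int2f.
  apply: le_lt_trans; apply: ge0_le_integral => //.
  - by move=> r _; rewrite lee_fin.
  - by apply/measurable_EFinP; exact: measurable_funTS.
  - by apply: measurableT_comp => //; apply/measurable_EFinP; exact: measurable_funTS.
  - by move=> r _; rewrite lee_fin ler_norm.
(* The same measure, packed with the proof that it is finite. *)
pose nuf : {finite_measure set (measurableTypeR R) -> \bar R} :=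
  HB.pack (lebesgue_stieltjes_measure (cumulative_of nd1 c1))
    (Measure_isFinite.Build _ _ _ (lebesgue_stieltjes_measure (cumulative_of nd1 c1)) fin).
have dom : nuf `<< mu.
  apply/null_content_dominatesP => A mA A0; apply/eqP.
  rewrite -measure_le0 (le_trans (le2 _ mA))//.
  rewrite null_set_integral//.
  by apply/measurable_EFinP; exact: measurable_funTS.
have [g [g0 gfin intg gE]] := radon_nikodym_sigma_finite dom.
exists (fun r => fine (g r) - f r).
  have -> : EFin \o (fun r => fine (g r) - f r) = (g \- (EFin \o f))%E.
    by apply/funext => r /=; rewrite EFinB fineK.
  exact: integrableB.
have intfg : mu.-integrable setT (EFin \o (fun r => fine (g r))).
  by have -> : EFin \o (fun r => fine (g r)) = g by apply/funext => r /=; rewrite fineK.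
have primB t : primitive (fun r => fine (g r) - f r) t =
    primitive (fun r => fine (g r)) t - F t.
  by rewrite /primitive RintegralB//; exact: integrable_in.
have key s t : s <= t -> phi t - phi s = primitive (fun r => fine (g r) - f r) t -
    primitive (fun r => fine (g r) - f r) s.
  move=> st; rewrite !primB.
  suff : ((F t + phi t) - (F s + phi s)) = (primitive (fun r => fine (g r)) t -
      primitive (fun r => fine (g r)) s) by lra.
  apply: EFin_inj; rewrite primitiveB_ocE// -(stieltjes_itvoc nd1 c1 st).
  rewrite [LHS](gE `]s, t]%classic)//; apply: eq_integral => r _; by rewrite fineK.
move=> s t; have [|/ltW] := leP s t; first exact: key.
by move=> /key; lra.
Qed.

End density.

(** * The metric derivative of an absolutely continuous curve *)

Section metric_derivative.
Context {R : realType}.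
Local Notation mu := (@lebesgue_measure R).

Lemma linear_approx_le (F G : R -> R) (t l k : R) :
  linear_approx F t l -> linear_approx G t k ->
  (forall s u, s <= u -> `|F u - F s| <= G u - G s) -> `|l| <= k.
Proof.
move=> Fl Gk FG; apply/ler_addgt0Pr => e e0.
have e20 : 0 < e / 2 by rewrite divr_gt0.
near t^'+ => s.
have ts : t < s by near: s; exact: nbhs_right_gt.
have Fs : `|F s - F t - l * (s - t)| <= e / 2 * `|s - t|.
  by near: s; exact: cvg_within (Fl _ e20).
have Gs : `|G s - G t - k * (s - t)| <= e / 2 * `|s - t|.
  by near: s; exact: cvg_within (Gk _ e20).
have st0 : 0 < s - t by rewrite subr_gt0.
rewrite -(ler_pM2r st0).
have := FG _ _ (ltW ts).
rewrite (gtr0_norm st0) in Fs Gs.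
have ls : `|l| * (s - t) = `|l * (s - t)| by rewrite normrM (gtr0_norm st0).
rewrite ls.
have : `|l * (s - t)| <= `|F s - F t| + `|F s - F t - l * (s - t)|.
  by rewrite -{1}(subKr (F s - F t) (l * (s - t))) ler_normB.
move: Gs; rewrite ler_norml => /andP[_ Gs].
move: (`|l * (s - t)|) (`|F s - F t|) (`|F s - F t - l * (s - t)|) Fs Gs.
move=> a b c; lra.
Unshelve. all: by end_near. Qed.

Definition rational_seq (n : nat) : R := ratr (odflt 0%Q (unpickle n)).

Lemma rational_seq_dense (a b : R) : a < b -> exists n, a < rational_seq n < b.
Proof.
move=> ab; have [q] := rat_in_itvoo ab; rewrite in_itv/= => qab.
by exists (pickle q); rewrite /rational_seq pickleK.
Qed.

Context {X : metricType R}.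
Implicit Types g : R -> X.

Lemma mdist_lipschitz (p a b : X) : `|mdist p a - mdist p b| <= mdist a b.
Proof.
rewrite ler_norml; have := metric_triangle p a b; have := metric_triangle p b a.
by rewrite (metric_sym b a); lra.
Qed.

(** Let [phi n] be the distance to the n-th point of a countable set of points of
    the curve, and [h n] its density. The candidate is the supremum [m] of the
    [`|h n|]. The increments of [phi n] are at most the distances between points
    of the curve, and taking the n-th point close to [g s] recovers
    [mdist (g s) (g t)] from them. The first fact makes [m] a lower bound for
    the difference quotients of the distance, and the second bounds the distance
    by the integral of [m], hence the quotients by [m] at its Lebesgue points. *)
Lemma metric_derivative g (f : R -> R) :
  mu.-integrable setT (EFin \o f) -> (forall r, 0 <= f r) ->
  (forall s t, s <= t -> mdist (g s) (g t) <= primitive f t - primitive f s) ->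
  exists m : R -> R, [/\ mu.-integrable setT (EFin \o m),
    forall r, 0 <= m r,
    forall s t, s <= t -> mdist (g s) (g t) <= primitive m t - primitive m s &
    {ae mu, forall t, mdist (g t) (g s) / `|s - t| @[s --> t^'] --> m t}].
Proof.
move=> intf f0 gf.
pose phi n t := mdist (g (rational_seq n)) (g t).
have phiL n s t : `|phi n t - phi n s| <= mdist (g s) (g t).
  by rewrite metric_sym; exact: mdist_lipschitz.
have phif n s t : s <= t -> `|phi n t - phi n s| <= primitive f t - primitive f s.
  by move=> st; rewrite (le_trans (phiL _ _ _))// gf.
have /(_ _)/cid2-/all_sig2[h hint hE] n := dominated_primitive intf f0 (phif n).
have mf : measurable_fun setT f by exact: integrable_measurable_fun intf.
have mh n : measurable_fun setT (h n) by exact: integrable_measurable_fun (hint n).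
(* Truncating by [f] changes nothing almost everywhere, and makes the
   supremum finite at every point. *)
pose u n t := Num.min `|h n t| (f t).
have u0 n t : 0 <= u n t by rewrite /u le_min normr_ge0 f0.
have uf n t : u n t <= f t by rewrite /u ge_min lexx orbT.
have ubu t : has_ubound (range (u ^~ t)) by exists (f t) => _ [n _ <-].
pose m t := sups (u ^~ t) 0%N.
have um n t : u n t <= m t.
  rewrite /m /sups/=; apply: ub_le_sup; last by exists n.
  by case: (ubu t) => b bP; exists b => _ [k _ <-]; apply: bP; exists k.
have m_le_f t : m t <= f t.
  by rewrite /m /sups/=; apply: ge_sup; [exists (u 0%N t), 0%N|move=> _ [k _ <-]].
have m0 t : 0 <= m t by rewrite (le_trans (u0 0%N t)).
have mm : measurable_fun setT m.
  apply: measurable_fun_sups => [t _|n]; first exact: ubu.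
  apply: measurable_minr => //; exact: measurableT_comp.
have intm : mu.-integrable setT (EFin \o m).
  apply: le_integrable intf => //; first exact/measurable_EFinP.
  by move=> t _ /=; rewrite lee_fin !ger0_norm.
have ae : {ae mu, forall t, [/\ linear_approx (primitive m) t (m t),
    linear_approx (primitive f) t (f t) &
    forall n, linear_approx (primitive (h n)) t (h n t)]}.
  have H1 := primitive_ae_approx intm.
  have H2 := primitive_ae_approx intf.
  have H3 := ae_foralln (fun n => primitive_ae_approx (hint n)).
  move: H1 H2 H3; apply: filterS3; first exact: (ae_filter_ringOfSetsType mu).
  by [].
have hf t : linear_approx (primitive f) t (f t) ->
    (forall n, linear_approx (primitive (h n)) t (h n t)) ->
    forall n, `|h n t| <= f t.
  move=> ft ht n; apply: linear_approx_le (ht n) ft _ => s v sv.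
  by rewrite -hE; exact: phif.
have hm t : linear_approx (primitive f) t (f t) ->
    (forall n, linear_approx (primitive (h n)) t (h n t)) ->
    forall n, `|h n t| <= m t.
  by move=> ft ht n; rewrite (le_trans _ (um n t))// /u le_min lexx hf.
have gm s t : s <= t -> mdist (g s) (g t) <= primitive m t - primitive m s.
  move=> st.
  have phim n : `|phi n t - phi n s| <= primitive m t - primitive m s.
    rewrite hE primitiveB//; apply: (le_trans (le_normr_Rintegral _ _)) => //.
      exact: integrable_in.
    rewrite -lee_fin primitiveB_ocE// /Rintegral fineK; last first.
      apply: integrable_fin_num => //; apply: integrable_in => //.
      exact: (integrable_norm (hint n)).
    apply: ae_ge0_le_integral => //.
    - by apply/measurable_EFinP/measurable_funTS; apply: measurableT_comp => //; exact: mh.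
    - by move=> r _; rewrite lee_fin.
    - by apply/measurable_EFinP; exact: measurable_funTS.
    move: ae; apply: filterS; first exact: (ae_filter_ringOfSetsType mu).
    by move=> r [_ fr hr] _; rewrite lee_fin hm.
  apply/ler_addgt0Pr => e e0.
  have e20 : 0 < e / 2 by rewrite divr_gt0.
  have cs : primitive f r @[r --> s] --> primitive f s by exact: primitive_continuous.
  move/(@cvgrPdist_lt _ R) : cs => /(_ _ e20)[d /= d0 dP].
  have [n /andP[n1 n2]] : exists n, s < rational_seq n < s + d.
    by apply: rational_seq_dense; rewrite ltrDl.
  have dn : mdist (g s) (g (rational_seq n)) <= e / 2.
    rewrite (le_trans (gf _ _ (ltW n1)))//.
    rewrite (le_trans (ler_norm _))// distrC ltW//; apply: dP => /=.
    by rewrite distrC gtr0_norm ?subr_gt0// ltrBlDl.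
  have := phim n; rewrite ler_norml /phi => /andP[_].
  have := metric_triangle (g s) (g (rational_seq n)) (g t).
  rewrite (metric_sym (g (rational_seq n)) (g s)).
  by move: dn; lra.
exists m; split => //.
move: ae; apply: filterS; first exact: (ae_filter_ringOfSetsType mu).
move=> t [mt ft ht]; apply/(@cvgrPdist_le _ R) => e e0.
have e20 : 0 < e / 2 by rewrite divr_gt0.
have [_ [n _ <-] nm] : exists2 x, range (u ^~ t) x & m t - e / 2 < x.
  have -> : range (u ^~ t) = sdrop (u ^~ t) 0%N.
    by apply/seteqP; split => _ [k _ <-]; exists k.
  apply: sup_adherent => //; split; first by exists (u 0%N t), 0%N.
  by case: (ubu t) => b bP; exists b => _ [k _ <-]; apply: bP; exists k.
have {}nm : m t - e / 2 < `|h n t|.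
  by rewrite (lt_le_trans nm)// /u ge_min lexx.
near=> s.
have st : s != t by near: s; exact: nbhs_dnbhs_neq.
have st0 : 0 < `|s - t| by rewrite normr_gt0 subr_eq0.
have H1 : `|primitive m s - primitive m t - m t * (s - t)| <= e * `|s - t|.
  by near: s; apply: cvg_within (mt _ e0).
have H2 : `|primitive (h n) s - primitive (h n) t - h n t * (s - t)|
    <= e / 2 * `|s - t|.
  by near: s; apply: cvg_within (ht n _ e20).
rewrite -(ler_pM2r st0) -[X in _ * X <= _](gtr0_norm st0) -normrM mulrBl.
rewrite -mulrA mulVf ?gt_eqF// mulr1 ler_norml; apply/andP; split.
  have : mdist (g t) (g s) <= `|primitive m s - primitive m t|.
    have [/ltW ts|ts] := ltP t s; first by rewrite (le_trans (gm _ _ ts))// ler_norm.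
    by rewrite metric_sym (le_trans (gm _ _ ts))// distrC ler_norm.
  have : `|primitive m s - primitive m t| <=
      `|primitive m s - primitive m t - m t * (s - t)| + `|m t * (s - t)|.
    by rewrite -{1}(subrK (m t * (s - t)) (primitive m s - primitive m t)) ler_normD.
  rewrite normrM (ger0_norm (m0 t)).
  by move: H1; lra.
have : `|h n t * (s - t)| <= `|primitive (h n) s - primitive (h n) t| +
    `|primitive (h n) s - primitive (h n) t - h n t * (s - t)|.
  by rewrite -{1}(subKr (primitive (h n) s - primitive (h n) t) (h n t * (s - t)))
    ler_normB.
rewrite -hE normrM; have := phiL n t s.
have : (m t - e / 2) * `|s - t| <= `|h n t| * `|s - t| by rewrite ler_wpM2r// ltW.
rewrite -hE in H2; move: H2; lra.
Unshelve. all: by end_near. Qed.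

End metric_derivative.

(** * The action of a curve on the unit interval *)

Section integral_without_measurability.
Local Open Scope ereal_scope.
Context d (T : measurableType d) (R : realType).
Variable mu : {measure set T -> \bar R}.
Implicit Types (D : set T) (f g : T -> \bar R).
Import HBNNSimple.

(** Without measurability the integral of a nonnegative function is the supremum
    of the integrals of the simple functions below it, which is monotone. This
    matters because the metric speed is a limit of difference quotients and is
    not known to be Borel. *)
Lemma ge0_le_integral_lower D f g : (forall x, D x -> 0 <= f x) ->
  (forall x, D x -> f x <= g x) ->
  \int[mu]_(x in D) f x <= \int[mu]_(x in D) g x.
Proof.
move=> f0 fg.
have g0 x : D x -> 0 <= g x by move=> Dx; rewrite (le_trans (f0 x Dx))// fg.
rewrite !ge0_integralE//; apply: le_ereal_sup => _ [h hf <-] /=.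
exists h => // x.
rewrite (le_trans (hf x))// /patch; case: ifPn => // xD; apply: fg.
exact: set_mem.
Qed.

Lemma ge0_ae_eq_integral_lower D f g : measurable D -> measurable_fun D g ->
  (forall x, D x -> 0 <= f x) -> (forall x, D x -> 0 <= g x) ->
  {ae mu, forall x, D x -> f x = g x} ->
  \int[mu]_(x in D) f x = \int[mu]_(x in D) g x.
Proof.
move=> mD mg f0 g0 [N [mN N0 fgN]].
have mN' : measurable_fun D (fun x => x \in N).
  apply: (measurable_fun_bool true) => //.
  rewrite (_ : _ @^-1` _ = N); first exact: measurableI.
  by apply/seteqP; split => x /=; [move/set_mem|move/mem_set].
have fgE x : D x -> ~ N x -> f x = g x.
  by move=> Dx Nx; apply: contrapT => fgx; apply: Nx; apply: fgN => /= /(_ Dx).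
apply/eqP; rewrite eq_le; apply/andP; split.
  (* Changing [g] on the null set [N], to [+oo] here and to [0] below,
     brackets [f] between two measurable functions of the same integral. *)
  pose g' x := if x \in N then +oo else g x.
  have -> : \int[mu]_(x in D) g x = \int[mu]_(x in D) g' x.
    apply: ge0_ae_eq_integral => //.
    - by apply: measurable_fun_if => //; apply: measurable_funS mg.
    - by move=> x Dx; rewrite /g'; case: ifP => // _; exact: g0.
    exists N; split => // x /= /not_implyP[Dx]; rewrite /g'.
    by case: ifPn => [/set_mem|_ []].
  apply: ge0_le_integral_lower => // x Dx; rewrite /g'.
  case: ifPn => [_|/negP xN]; first exact: leey.
  by rewrite fgE// => Nx; apply: xN; exact: mem_set.
pose g' x := if x \in N then 0 else g x.
have -> : \int[mu]_(x in D) g x = \int[mu]_(x in D) g' x.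
  apply: ge0_ae_eq_integral => //.
  - by apply: measurable_fun_if => //; apply: measurable_funS mg.
  - by move=> x Dx; rewrite /g'; case: ifP => // _; exact: g0.
  exists N; split => // x /= /not_implyP[Dx]; rewrite /g'.
  by case: ifPn => [/set_mem|_ []].
apply: ge0_le_integral_lower => x Dx; rewrite /g'; case: ifPn => // /negP xN.
- exact: g0.
- by rewrite f0.
by rewrite fgE// => Nx; apply: xN; exact: mem_set.
Qed.

End integral_without_measurability.

Section curves_on_unit_interval.
Context {R : realType} {X : metricType R}.
Local Notation mu := (@lebesgue_measure R).
Implicit Types (g : R -> X) (h m : R -> R).

(** Absolute continuity with the bound made explicit. The function [h] lives on
    the whole line so that its primitive does. *)
Definition dominates_speed h g := [/\ mu.-integrable setT (EFin \o h),
  forall r, 0 <= h r &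
  forall s t, 0 <= s -> s <= t -> t <= 1 ->
    mdist (g s) (g t) <= primitive h t - primitive h s].

Lemma dominates_speed_abs_cont h g : dominates_speed h g -> abs_cont 0 1 g.
Proof.
move=> [inth h0 hg]; exists h; first exact: integrable_in.
by move=> s t s0 st t1; rewrite -primitiveB_ccE// lee_fin hg.
Qed.

Lemma abs_cont_dominates_speed g : abs_cont 0 1 g ->
  exists h, dominates_speed h g.
Proof.
move=> [f intf fg]; exists (fun r => `|(f \_ `[0, 1]) r|).
have intf' : mu.-integrable setT (EFin \o (f \_ `[0, 1])).
  by rewrite -restrict_EFin; apply/(integrable_mkcond _ _).1.
have inth : mu.-integrable setT (EFin \o (fun r => `|(f \_ `[0, 1]) r|)).
  exact: (integrable_norm intf').
split => // s t s0 st t1; rewrite -lee_fin primitiveB_ccE//.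
apply: (le_trans (fg s t s0 st t1)).
have sub : `[s, t] `<=` `[0, 1]%classic.
  by move=> r /=; rewrite !in_itv/= => /andP[sr rt]; rewrite (le_trans s0)//= (le_trans rt).
have ists : mu.-integrable `[s, t] (EFin \o f) by apply: integrableS intf.
apply: le_integral => //; first exact: integrable_in.
by move=> r; rewrite inE => /sub r01; rewrite lee_fin /patch mem_set// ler_norm.
Qed.

(** The projection onto the unit interval. Precomposing with it extends a curve by
    constants, and turns statements on the unit interval into statements on the
    line. *)
Definition clamp (t : R) : R := Num.max 0 (Num.min t 1).

Lemma clamp_id t : 0 <= t <= 1 -> clamp t = t.
Proof. by move=> /andP[t0 t1]; rewrite /clamp (min_idPl t1) (max_idPr t0). Qed.

Lemma clamp_itv t : 0 <= clamp t <= 1.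
Proof. by rewrite /clamp le_max lexx/= ge_max ler01 ge_min lexx orbT. Qed.

Lemma dominates_speed_clamp h g : dominates_speed h g ->
  forall s t, s <= t ->
    mdist (g (clamp s)) (g (clamp t)) <= primitive h t - primitive h s.
Proof.
move=> [inth h0 hg] s t st.
have [->|cst] := eqVneq (clamp s) (clamp t).
  by rewrite mdistxx subr_ge0 (primitive_nd inth).
have /andP[cs0 cs1] := clamp_itv s; have /andP[ct0 ct1] := clamp_itv t.
have cs_le_ct : clamp s <= clamp t.
  rewrite /clamp; move: st; rewrite /Num.max /Num.min.
  by do ! case: ifPn; rewrite -?leNgt; lra.
have scs : s <= clamp s.
  move: cst cs_le_ct; rewrite neq_lt /clamp /Num.max /Num.min.
  do ! case: ifPn; rewrite -?leNgt; lra.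
have ctt : clamp t <= t.
  move: cst cs_le_ct; rewrite neq_lt /clamp /Num.max /Num.min.
  do ! case: ifPn; rewrite -?leNgt; lra.
apply: (le_trans (hg _ _ cs0 cs_le_ct ct1)).
by apply: lerB; apply: (primitive_nd inth).
Qed.

Lemma dominates_speed_continuous h g : dominates_speed h g ->
  continuous (g \o clamp).
Proof.
move=> hg t; have [inth h0 _] := hg.
apply/(@metricType_numDomainType.cvgrPdist_le R X) => e e0.
have cs : primitive h r @[r --> t] --> primitive h t by exact: primitive_continuous.
move/(@cvgrPdist_le _ R) : cs => /(_ _ e0); apply: filterS => s /=.
apply: le_trans; have [st|/ltW ts] := leP s t.
  by rewrite metric_sym (le_trans (dominates_speed_clamp hg st))// ler_norm.
by rewrite distrC (le_trans (dominates_speed_clamp hg ts))// ler_norm.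
Qed.

Lemma clamp_continuous_within g : continuous (g \o clamp) ->
  {within `[0%R, 1%R], continuous g}.
Proof.
move=> cg; apply: (@subspace_eq_continuous _ _ _ (g \o clamp)).
  by move=> t; rewrite inE/= in_itv/= => t01; rewrite clamp_id.
exact: continuous_subspaceT.
Qed.

(** The metric derivative of the extended curve is that of the curve at interior
    points of the interval. *)
Lemma abs_cont_metric_speed g : abs_cont 0 1 g ->
  exists2 m, dominates_speed m g &
  {ae mu, forall t, 0 < t < 1 -> mdist (g t) (g s) / `|s - t| @[s --> t^'] --> m t}.
Proof.
move=> /abs_cont_dominates_speed[h hg]; have [inth h0 _] := hg.
have [m [intm m0 mg mE]] := metric_derivative inth h0 (dominates_speed_clamp hg).
exists m.
  split => // s t s0 st t1; have := mg _ _ st; rewrite !clamp_id//.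
    by rewrite (le_trans s0 st).
  by rewrite s0 (le_trans st t1).
move: mE; apply: filterS; first exact: (ae_filter_ringOfSetsType mu).
move=> t mt /andP[t0 t1]; apply: cvg_trans mt; apply: near_eq_cvg.
rewrite near_withinE.
have nt : \forall s \near t, 0 < s < 1.
  near=> s; apply/andP; split; near: s; [exact: lt_nbhsr|exact: lt_nbhsl].
move: nt; apply: filterS => s /andP[s0 s1] _.
by rewrite /= !clamp_id// ?(ltW t0) ?(ltW t1) ?(ltW s0) ?(ltW s1).
Unshelve. all: by end_near. Qed.

Lemma ae_unit_interval (P : R -> Prop) :
  {ae mu, forall t, 0 < t < 1 -> P t} -> {ae mu, forall t, `[0, 1]%classic t -> P t}.
Proof.
have n0 : {ae mu, forall t : R, t <> 0}.
  exists [set 0]; split => //; first exact: lebesgue_measure_set1.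
  by move=> t /=; apply: contra_notP.
have n1 : {ae mu, forall t : R, t <> 1}.
  exists [set 1]; split => //; first exact: lebesgue_measure_set1.
  by move=> t /=; apply: contra_notP.
move: n0 n1; apply: filterS3; first exact: (ae_filter_ringOfSetsType mu).
move=> t /eqP t0 /eqP t1 Pt /=; rewrite in_itv/= => /andP[t0' t1'].
by apply: Pt; rewrite !lt_neqAle t0' t1' t1 eq_sym t0.
Qed.

(** The squared L2 norm on the unit interval. *)
Definition sq_int h : \bar R := (\int[mu]_(t in `[0%R, 1%R]) (h t ^+ 2)%:E)%E.

Lemma action_metric_speed g m : abs_cont 0 1 g -> dominates_speed m g ->
  {ae mu, forall t, 0 < t < 1 -> mdist (g t) (g s) / `|s - t| @[s --> t^'] --> m t} ->
  (\int[mu]_(t in `[0%R, 1%R]) (metric_speed g t ^+ 2)%:E)%E = sq_int m.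
Proof.
move=> acg [intm m0 _] mE; apply: ge0_ae_eq_integral_lower => //.
- apply/measurable_EFinP; apply: measurable_funX; apply: measurable_funTS.
  exact: (integrable_measurable_fun intm).
- by move=> t _; rewrite lee_fin sqr_ge0.
- by move=> t _; rewrite lee_fin sqr_ge0.
apply: (@ae_unit_interval (fun t => (metric_speed g t ^+ 2)%:E = (m t ^+ 2)%:E)).
move: mE; apply: filterS; first exact: (ae_filter_ringOfSetsType mu).
move=> t + t01 => /(_ t01) mt; rewrite /metric_speed; congr ((_ ^+ 2)%:E).
exact: cvg_lim mt.
Qed.

Lemma abs_cont_action g : abs_cont 0 1 g ->
  exists2 m, dominates_speed m g & action g = ((2^-1)%:E * sq_int m)%E.
Proof.
move=> acg; have [m mg mE] := abs_cont_metric_speed acg; exists m => //.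
by rewrite /action asboolT// (action_metric_speed acg mg mE).
Qed.

(** The metric speed is the least function whose integral dominates the distance:
    at a Lebesgue point of [h], the difference quotients of the distance are at
    most [h t + e]. *)
Lemma dominates_speed_action g h : dominates_speed h g ->
  (action g <= (2^-1)%:E * sq_int h)%E.
Proof.
move=> hg; have [inth h0 hgE] := hg.
have acg := dominates_speed_abs_cont hg.
have [m mg mE] := abs_cont_metric_speed acg.
rewrite /action asboolT// (action_metric_speed acg mg mE).
apply: lee_wpmul2l; first by rewrite lee_fin invr_ge0.
have [intm m0 _] := mg.
apply: ae_ge0_le_integral => //.
- by move=> t _; rewrite lee_fin sqr_ge0.
- apply/measurable_EFinP; apply: measurable_funX; apply: measurable_funTS.
  exact: (integrable_measurable_fun intm).
- by move=> t _; rewrite lee_fin sqr_ge0.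
- apply/measurable_EFinP; apply: measurable_funX; apply: measurable_funTS.
  exact: (integrable_measurable_fun inth).
apply: (@ae_unit_interval (fun t => ((m t ^+ 2)%:E <= (h t ^+ 2)%:E)%E)).
move: mE (primitive_ae_approx inth); apply: filterS2.
  exact: (ae_filter_ringOfSetsType mu).
move=> t + ht t01 => /(_ t01) mt; rewrite lee_fin.
rewrite ler_sqr ?nnegrE//; apply/ler_addgt0Pr => e e0.
have : \forall s \near t^', mdist (g t) (g s) / `|s - t| <= h t + e.
  near=> s.
  have st : s != t by near: s; exact: nbhs_dnbhs_neq.
  have H : `|primitive h s - primitive h t - h t * (s - t)| <= e * `|s - t|.
    by near: s; exact: cvg_within (ht _ e0).
  have s01 : 0 <= s <= 1.
    near: s; apply: cvg_within; have /andP[t0 t1] := t01.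
    by near=> s; apply/andP; split; apply: ltW; near: s;
      [exact: lt_nbhsr|exact: lt_nbhsl].
  rewrite ler_pdivrMr ?normr_gt0 ?subr_eq0//.
  have : mdist (g t) (g s) <= `|primitive h s - primitive h t|.
    have /andP[s0 s1] := s01; have /andP[t0 t1] := t01.
    have [ts|/ltW ts] := leP t s.
      by rewrite (le_trans (hgE _ _ (ltW t0) ts s1))// ler_norm.
    by rewrite metric_sym (le_trans (hgE _ _ s0 ts (ltW t1)))// distrC ler_norm.
  have : `|primitive h s - primitive h t| <=
      `|primitive h s - primitive h t - h t * (s - t)| + `|h t * (s - t)|.
    by rewrite -{1}(subrK (h t * (s - t)) (primitive h s - primitive h t)) ler_normD.
  rewrite normrM (ger0_norm (h0 t)).
  by move: H; lra.
exact: cvgr_to_le mt.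
Unshelve. all: by end_near. Qed.

End curves_on_unit_interval.

(** * Fast Cauchy sequences in L1 *)

Section fast_cauchy.
Context {R : realType}.
Local Notation mu := (@lebesgue_measure R).

Lemma sum_geometric_half_le (c : R) n : 0 <= c ->
  \sum_(0 <= k < n) c * 2^-1 ^+ k <= c * 2.
Proof.
move=> c0; suff -> : \sum_(0 <= k < n) c * 2^-1 ^+ k = c * (2 - 2 * 2^-1 ^+ n).
  by rewrite ler_wpM2l// gerBl mulr_ge0// exprn_ge0// invr_ge0.
elim: n => [|n IH]; first by rewrite big_geq// expr0; ring.
by rewrite big_nat_recr//= IH exprS; field.
Qed.

(** The sum of the [`|u k.+1 - u k|] is integrable by monotone convergence, hence
    finite almost everywhere. There [u] converges, and together with [u 0] this
    sum dominates the sequence. *)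
Lemma fast_cauchy_cvg (u : nat -> R -> R) (c : R) : 0 <= c ->
  (forall k, mu.-integrable setT (EFin \o u k)) -> (forall k r, 0 <= u k r) ->
  (forall k, (\int[mu]_r (`|u k.+1 r - u k r|)%:E <= (c * 2^-1 ^+ k)%:E)%E) ->
  exists g : R -> R, [/\ mu.-integrable setT (EFin \o g), forall r, 0 <= g r,
    {ae mu, forall r, u k r @[k --> \oo] --> g r} &
    forall t, primitive (u k) t @[k --> \oo] --> primitive g t].
Proof.
move=> c0 intu u0 uc.
have mu_ k : measurable_fun setT (u k) by exact: integrable_measurable_fun (intu k).
pose D k r := (`|u k.+1 r - u k r|)%:E.
have D0 k r : (0 <= D k r)%E by rewrite lee_fin.
have mD k : measurable_fun setT (D k).
  by apply/measurable_EFinP; apply: measurableT_comp => //; exact: measurable_funB.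
pose S r := (\sum_(k <oo) D k r)%E.
have S0 r : (0 <= S r)%E by exact: nneseries_ge0.
have mS : measurable_fun setT S.
  by apply: ge0_emeasurable_sum.
have intS : mu.-integrable setT S.
  apply/integrableP; split => //.
  under eq_integral do rewrite gee0_abs//.
  rewrite integral_nneseries//; apply: (@le_lt_trans _ _ (c * 2)%:E); last exact: ltry.
  apply: lime_le; first by apply: is_cvg_nneseries => k _ _; exact: integral_ge0.
  apply: nearW => n; rewrite (@le_trans _ _ (\sum_(0 <= k < n) (c * 2^-1 ^+ k)%:E)%E)//.
    by apply: lee_sum => k _; exact: uc.
  by rewrite sumEFin lee_fin sum_geometric_half_le.
have uS n r : ((u n r)%:E <= (u 0%N r)%:E + S r)%E.
  apply: (@le_trans _ _ ((u 0%N r)%:E + \sum_(0 <= k < n) D k r)%E).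
    elim: n => [|n IH]; first by rewrite big_geq// adde0.
    rewrite big_nat_recr//= addeA; apply: le_trans (leeD2r _ IH).
    by rewrite /D -EFinD lee_fin -lerBlDl ler_norm.
  by rewrite leeD2l//; apply: nneseries_lim_ge.
have cvgu r : S r \is a fin_num -> cvg (u k r @[k --> \oo]).
  move=> Sr.
  have : cvgn [normed series (fun k => u k.+1 r - u k r)].
    apply: nondecreasing_is_cvgn.
      by apply: nondecreasing_series => k _ _; exact: normr_ge0.
    exists (fine (S r)) => _ [n _ <-]; rewrite -lee_fin fineK//.
    by rewrite /series/= -sumEFin; apply: nneseries_lim_ge.
  move=> /normed_cvg/cvg_ex[/= l sl].
  apply/cvg_ex; exists (l + u 0%N r).
  have -> : (fun k => u k r) = (fun n => series (fun k => u k.+1 r - u k r) n + u 0%N r).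
    apply/funext => n; rewrite /series/=; elim: n => [|n IH].
      by rewrite big_geq// add0r.
    by rewrite big_nat_recr//= addrAC -IH; ring.
  by apply: (@cvgD _ R) => //; exact: cvg_cst.
(* The upper limit is measurable, and is the limit wherever there is one. The
   absolute value only acts where there is none. *)
pose g r := `|fine (limn_esup (fun k => (u k r)%:E))|.
have mg : measurable_fun setT g.
  apply: measurableT_comp => //; apply: measurableT_comp => //.
  by apply: measurable_fun_limn_esup => k; apply/measurable_EFinP.
have ug : {ae mu, forall r, u k r @[k --> \oo] --> g r}.
  have : {ae mu, forall r, setT r -> S r \is a fin_num}.
    exact: (integrable_ae measurableT intS).
  apply: filterS; first exact: (ae_filter_ringOfSetsType mu).
  move=> r /(_ Logic.I)/cvgu/cvg_ex[/= l ul].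
  have l0 : 0 <= l by apply: cvgr_to_ge ul _; exact: nearW.
  suff -> : g r = l by [].
  rewrite /g; have -> : limn_esup (fun k => (u k r)%:E) = l%:E.
    have ul' : (u k r)%:E @[k --> \oo] --> l%:E by apply/cvg_EFin => //; exact: nearW.
    by rewrite (cvg_limn_einf_sup ul').2.
  by rewrite /= ger0_norm.
have intg0 : mu.-integrable setT (fun r => (u 0%N r)%:E + S r)%E.
  exact: (integrableD measurableT (intu 0%N) intS).
have dom t := @dominated_convergence _ _ R mu `]-oo, t] (measurable_itv _)
  (fun k r => (u k r)%:E) (EFin \o g) (fun r => (u 0%N r)%:E + S r)%E.
have intg : mu.-integrable setT (EFin \o g).
  have [] := @dominated_convergence _ _ R mu setT measurableT
    (fun k r => (u k r)%:E) (EFin \o g) (fun r => (u 0%N r)%:E + S r)%E => //.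
  - by move=> n; apply/measurable_EFinP; exact: mu_.
  - exact/measurable_EFinP.
  - move: ug; apply: filterS; first exact: (ae_filter_ringOfSetsType mu).
    by move=> r ur _; apply/cvg_EFin => //; exact: nearW.
  - by apply: aeW => r n _; rewrite /= ger0_norm.
exists g; split => // [r|t]; first exact: normr_ge0.
have [] := dom t.
- by move=> n; apply/measurable_EFinP; apply: measurable_funTS; exact: mu_.
- by apply/measurable_EFinP; exact: measurable_funTS.
- move: ug; apply: filterS; first exact: (ae_filter_ringOfSetsType mu).
  by move=> r ur _; apply/cvg_EFin => //; exact: nearW.
- exact: integrableS intg0.
- by apply: aeW => r n _; rewrite /= ger0_norm.
move=> _ _; rewrite /primitive /Rintegral.
have fin : (\int[mu]_(r in `]-oo, t]) (EFin \o g) r)%E \is a fin_num.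
  by apply: integrable_fin_num => //; exact: integrable_in.
by rewrite -(fineK fin) => /fine_cvg.
Qed.

End fast_cauchy.

(** * Elements of almost minimal L2 norm in decreasing convex sets *)

Section limn_einf_lemmas.
Local Open Scope ereal_scope.
Context {R : realType}.
Implicit Types (u v : (\bar R)^nat) (l : \bar R).

Lemma limn_einf_gt u l : l < limn_einf u -> \forall n \near \oo, l < u n.
Proof.
rewrite limn_einf_lim (cvg_lim _ (@cvg_einfs_sup _ u))//.
move=> /ereal_sup_gt[_ [N _ <-]] lN; exists N => // n /= Nn.
by apply: (lt_le_trans lN); apply: ereal_inf_lbound; exists n.
Qed.

Lemma le_limn_einf u v : (forall n, u n <= v n) -> limn_einf u <= limn_einf v.
Proof.
move=> uv; rewrite !limn_einf_lim; apply: lee_lim; [exact: is_cvg_einfs..|].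
apply: nearW => n; apply: le_ereal_inf_tmp => _ [k nk <-].
by apply: le_trans (uv k); apply: ereal_inf_lbound; exists k.
Qed.

Lemma limn_einf_le_cvg u v l : (forall n, u n <= v n) -> v @ \oo --> l ->
  limn_einf u <= l.
Proof.
by move=> uv vl; rewrite -(cvg_limn_einf_sup vl).1; exact: le_limn_einf.
Qed.

Lemma limn_einf_ge0 u : (forall n, 0 <= u n) -> 0 <= limn_einf u.
Proof.
move=> u0; apply: le_trans (le_limn_einf u0).
by rewrite (cvg_limn_einf_sup (cvg_cst _)).1.
Qed.

Lemma measurable_fun_limn_einf d (T : measurableType d) (D : set T)
    (f : (T -> \bar R)^nat) : (forall n, measurable_fun D (f n)) ->
  measurable_fun D (fun x => limn_einf (f ^~ x)).
Proof.
move=> mf; apply: measurableT_comp => //.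
by apply: measurable_fun_limn_esup => n; exact: measurableT_comp.
Qed.

End limn_einf_lemmas.

Section unit_L2.
Context {R : realType}.
Local Notation mu := (@lebesgue_measure R).
Implicit Types h k : R -> R.

Lemma ge0_sq_int h : (0 <= sq_int h)%E.
Proof. by apply: integral_ge0 => t _; rewrite lee_fin sqr_ge0. Qed.

(** The integrated form of [`|h| <= c / 2 + h ^+ 2 / (2 * c)]. The free parameter
    [c] stands in for the Cauchy-Schwarz inequality. *)
Lemma integral_norm_le_sq h (c : R) (A : set R) : measurable_fun setT h ->
  0 < c -> measurable A -> A `<=` `[0, 1]%classic ->
  (\int[mu]_(r in A) (`|h r|)%:E <=
    (c / 2)%:E * mu A + ((2 * c)^-1)%:E * sq_int h)%E.
Proof.
move=> mh c0 mA A01.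
have c20 : 0 <= (2 * c)^-1 by rewrite invr_ge0 mulr_ge0// ltW.
have ch0 r : 0 <= c / 2 + (2 * c)^-1 * h r ^+ 2.
  by apply: addr_ge0; [rewrite divr_ge0// ltW|rewrite mulr_ge0// sqr_ge0].
have mh2 B : measurable_fun B (fun r => (h r ^+ 2)%:E).
  by apply/measurable_EFinP; apply: measurable_funX; exact: measurable_funTS.
apply: (@le_trans _ _ (\int[mu]_(r in A) ((c / 2)%:E + ((2 * c)^-1)%:E * (h r ^+ 2)%:E))%E).
  apply: ge0_le_integral => //.
  - apply/measurable_EFinP; apply: measurableT_comp => //; exact: measurable_funTS.
  - apply: emeasurable_funD => //; apply: measurable_funeM; exact: mh2.
  move=> r _; rewrite -EFinM -EFinD lee_fin.
  rewrite -(ler_pM2r (mulr_gt0 (ltr0n _ 2) c0)).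
  have -> : (c / 2 + (2 * c)^-1 * h r ^+ 2) * (2 * c) = c ^+ 2 + `|h r| ^+ 2.
    by rewrite real_normK ?num_real//; field; rewrite gt_eqF.
  by have := sqr_ge0 (c - `|h r|); rewrite !expr2; lra.
rewrite ge0_integralD//; last 3 first.
- by move=> r _; rewrite lee_fin divr_ge0// ltW.
- by move=> r _; rewrite -EFinM lee_fin mulr_ge0// sqr_ge0.
- apply: measurable_funeM; exact: mh2.
rewrite integral_cst// leeD2l// ge0_integralZl_EFin//.
- apply: lee_wpmul2l; first by rewrite lee_fin.
  by apply: ge0_subset_integral => //; [exact: mh2|move=> r _; rewrite lee_fin sqr_ge0].
- by move=> r _; rewrite lee_fin sqr_ge0.
- exact: mh2.
Qed.

(** Vanishing outside the unit interval makes these functions integrable on the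
    whole line, where primitives are defined. *)
Definition unit_L2 h := [/\ measurable_fun setT h, forall r, 0 <= h r,
  forall r, ~ (0 <= r <= 1) -> h r = 0 & (sq_int h < +oo)%E].

Lemma integral_supported h : (forall r, ~ (0 <= r <= 1) -> h r = 0) ->
  (\int[mu]_r (h r)%:E = \int[mu]_(r in `[0%R, 1%R]) (h r)%:E)%E.
Proof.
move=> h0; rewrite [RHS]integral_mkcond; apply: eq_integral => r _.
rewrite /patch; case: ifPn => //; rewrite mem_setE in_itv/= => /negP r01.
by rewrite h0.
Qed.

Lemma integral_norm_supported_le_sq h (c : R) : measurable_fun setT h ->
  (forall r, ~ (0 <= r <= 1) -> h r = 0) -> 0 < c ->
  (\int[mu]_r (`|h r|)%:E <= (c / 2)%:E + ((2 * c)^-1)%:E * sq_int h)%E.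
Proof.
move=> mh h0 c0; rewrite (@integral_supported (fun r => `|h r|)); last first.
  by move=> r /h0 ->; rewrite normr0.
have := integral_norm_le_sq mh c0 (measurable_itv `[0%R, 1%R]) (@subset_refl _ _).
by rewrite /= lebesgue_measure_itv/= lte_fin ltr01 sube0 mule1.
Qed.

Lemma unit_L2_integrable h : unit_L2 h -> mu.-integrable setT (EFin \o h).
Proof.
move=> [mh h0 hs hL2]; apply/integrableP; split; first exact/measurable_EFinP.
apply: le_lt_trans (integral_norm_supported_le_sq mh hs ltr01) _.
by rewrite lte_add_pinfty ?ltry// lte_mul_pinfty.
Qed.

Lemma parallelogram h k : measurable_fun setT h -> measurable_fun setT k ->
  (sq_int (fun r => h r - k r)%R + 4%:E * sq_int (fun r => (h r + k r) / 2)%R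
    = 2%:E * sq_int h + 2%:E * sq_int k)%E.
Proof.
move=> mh mk.
have msq (f : R -> R) (A : set R) : measurable_fun setT f ->
    measurable_fun A (fun r => (f r ^+ 2)%:E).
  by move=> mf; apply/measurable_EFinP; apply: measurable_funX; exact: measurable_funTS.
have mB : measurable_fun setT (fun r => h r - k r) by exact: measurable_funB.
have mD : measurable_fun setT (fun r => (h r + k r) / 2).
  by apply: measurable_funM => //; exact: measurable_funD.
have sq0 (f : R -> R) r : `[0%R, 1%R]%classic r -> (0 <= (f r ^+ 2)%:E)%E.
  by move=> _; rewrite lee_fin sqr_ge0.
have sc0 (c : R) (f : R -> R) r : 0 <= c -> `[0%R, 1%R]%classic r ->
    (0 <= c%:E * (f r ^+ 2)%:E)%E.
  by move=> c0 _; rewrite -EFinM lee_fin mulr_ge0// sqr_ge0.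
rewrite /sq_int -!ge0_integralZl_EFin//; last 6 first.
- by move=> r; exact: sq0.
- exact: msq.
- by move=> r; exact: sq0.
- exact: msq.
- by move=> r; exact: (@sq0 (fun r => (h r + k r) / 2)).
- exact: msq.
rewrite -!ge0_integralD//.
- by apply: eq_integral => r _; rewrite -!EFinM -!EFinD; congr EFin; field.
- by move=> r; exact: (sc0 2 h).
- by apply: measurable_funeM; exact: msq.
- by move=> r; exact: (sc0 2 k).
- by apply: measurable_funeM; exact: msq.
- by move=> r; exact: (@sq0 (fun r => h r - k r)).
- exact: msq.
- by move=> r; exact: (sc0 4 (fun r => (h r + k r) / 2)).
- by apply: measurable_funeM; exact: msq.
Qed.

Lemma sq_int_fatou (h : nat -> R -> R) (g : R -> R) (l : R) (b : nat -> R) :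
  (forall n, measurable_fun setT (h n)) ->
  {ae mu, forall r, h n r @[n --> \oo] --> g r} -> measurable_fun setT g ->
  (forall n, (sq_int (h n) <= (b n)%:E)%E) -> b n @[n --> \oo] --> l ->
  (sq_int g <= l%:E)%E.
Proof.
move=> mh hg mg hb bl.
have msq (f : R -> R) (A : set R) : measurable_fun setT f ->
    measurable_fun A (fun r => (f r ^+ 2)%:E).
  by move=> mf; apply/measurable_EFinP; apply: measurable_funX; exact: measurable_funTS.
have hgE : {ae mu, forall r, `[0%R, 1%R]%classic r ->
    ((g r ^+ 2)%:E = limn_einf (fun n => (h n r ^+ 2)%:E))%E}.
  move: hg; apply: filterS; first exact: (ae_filter_ringOfSetsType mu).
  move=> r hr _; apply/esym; apply: (cvg_limn_einf_sup _).1.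
  by apply/cvg_EFin; [exact: nearW|exact: (cvgM hr hr)].
rewrite /sq_int (ge0_ae_eq_integral_lower _ _ _ _ hgE)//; last 3 first.
- by apply: measurable_fun_limn_einf => n; exact: msq.
- by move=> r _; rewrite lee_fin sqr_ge0.
- by move=> r _; apply: limn_einf_ge0 => n; rewrite lee_fin sqr_ge0.
apply: (@le_trans _ _ (limn_einf (fun n => sq_int (h n)))).
  apply: fatou => //.
  - by move=> n; exact: msq.
  - by move=> n r _; rewrite lee_fin sqr_ge0.
apply: limn_einf_le_cvg hb _.
by apply/cvg_EFin; [exact: nearW|].
Qed.

End unit_L2.

Section minimal_norm.
Context {R : realType}.
Local Notation mu := (@lebesgue_measure R).
Variables (K : nat -> set (R -> R)) (b : R).
Hypothesis K_L2 : forall n h, K n h -> unit_L2 h.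
Hypothesis K_decr : forall n h, K n.+1 h -> K n h.
Hypothesis K_midpoint : forall n h k, K n h -> K n k ->
  K n (fun r => (h r + k r) / 2).
Hypothesis K_bound : forall n e, 0 < e ->
  exists2 h, K n h & (sq_int h <= (b + e)%:E)%E.

Let N (h : R -> R) := fine (sq_int h).

Let NE n h : K n h -> (N h)%:E = sq_int h.
Proof.
by move=> /K_L2[_ _ _ hoo]; rewrite /N fineK// ge0_fin_numE// ge0_sq_int.
Qed.

Let K_le m n h : (m <= n)%N -> K n h -> K m h.
Proof.
elim: n => [|n IH]; first by rewrite leqn0 => /eqP ->.
by rewrite leq_eqVlt => /predU1P[->//|/IH mn /K_decr/mn].
Qed.

(** The supremum [d] of these numbers is the limit of the infima of [N] over the
    sets [K n], which are nondecreasing in [n]. *)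
Let eventual_lower_bounds := [set c : R | exists n, forall h, K n h -> c <= N h].

Let d := sup eventual_lower_bounds.

Let has_sup_d : has_sup eventual_lower_bounds.
Proof.
split; first by exists 0, 0%N => h /NE hE; rewrite -lee_fin hE ge0_sq_int.
exists (b + 1) => c [n nc].
have [h Kh hb] := K_bound n ltr01.
by rewrite (le_trans (nc h Kh))// -lee_fin (NE Kh).
Qed.

Let d_le_b : d <= b.
Proof.
apply/ler_addgt0Pr => e e0; apply: ge_sup; first by case: has_sup_d.
move=> c [n nc]; have [h Kh hb] := K_bound n e0.
by rewrite (le_trans (nc h Kh))// -lee_fin (NE Kh).
Qed.

(** A set [K n] on which [d - e] is a lower bound contains an element of norm
    below [d + e]: otherwise [d + e] would itself be an eventual lower bound. *)
Let almost_minimal e k : 0 < e -> exists h n, [/\ (k <= n)%N, K n h,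
  forall h', K n h' -> d - e <= N h' & N h <= d + e].
Proof.
move=> e0; have [c [n nc] dc] := sup_adherent e0 has_sup_d.
have [h [Kh hd]] : exists h, K (maxn k n) h /\ N h < d + e.
  apply: contrapT => /forallNP H.
  have : d + e <= d.
    apply: ub_le_sup; first by case: has_sup_d.
    exists (maxn k n) => h Kh; rewrite leNgt; apply/negP => hd.
    by apply: (H h).
  by rewrite gerDl leNgt e0.
exists h, (maxn k n); split => //; first exact: leq_maxl.
- move=> h' /(K_le (leq_maxr _ _))/nc; apply: le_trans; exact: ltW.
- exact: ltW.
Qed.

(** Two almost minimal elements of [K n] have their midpoint in [K n], so its norm
    is not much below the minimum, and the parallelogram identity forces them to
    be close. A fast choice makes the sequence converge in L1, and Fatou's lemma
    bounds the norm of the limit. *)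
Lemma minimal_norm_limit : exists g (h_ : nat -> R -> R),
  [/\ mu.-integrable setT (EFin \o g), forall r, 0 <= g r,
    (sq_int g <= b%:E)%E, forall k, K k (h_ k) &
    forall t, primitive (h_ k) t @[k --> \oo] --> primitive g t].
Proof.
pose e k : R := 4^-1 ^+ k.
have e0 k : 0 < e k by rewrite exprn_gt0.
have /(_ _)/cid-/all_sig[h_ hP] := fun k => almost_minimal k (e0 k).
have Kh k : K k (h_ k) by have [n [kn Kn _ _]] := hP k; exact: K_le kn Kn.
have mh k : measurable_fun setT (h_ k) by have [] := K_L2 (Kh k).
(* Parallelogram identity: [2 (d + e) + 2 (d + e) - 4 (d - e) = 8 e]. *)
have hD k : (sq_int (fun r => h_ k.+1 r - h_ k r)%R <= (8 * e k)%:E)%E.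
  have ek1 : e k.+1 <= e k.
    by rewrite /e exprS ger_pMl// invf_le1// ler1n.
  have [i [ki Ki i1 i2]] := hP k; have [j [kj Kj j1 j2]] := hP k.+1.
  (* The smaller of the indices attached to [h_ k] and [h_ k.+1] gives a set
     that contains both and carries the lower bound [d - e k]. *)
  have [n [Kn1 Kn2 nl]] : exists n, [/\ K n (h_ k), K n (h_ k.+1) &
      forall h', K n h' -> d - e k <= N h'].
    have [ij|/ltnW ji] := leqP i j.
      by exists i; split => //; exact: K_le ij Kj.
    exists j; split => //; first exact: K_le ji Ki.
    by move=> h' /j1; lra.
  have Kmid := K_midpoint Kn2 Kn1.
  have := parallelogram (mh k.+1) (mh k).
  rewrite -(NE Kmid) -(NE Kn1) -(NE Kn2) -!EFinM -EFinD => /eqP.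
  rewrite eq_sym -sube_eq//; last by rewrite fin_num_adde_defl.
  rewrite -EFinB => /eqP <-; rewrite lee_fin.
  by have := nl _ Kmid; move: i2 j2; lra.
have hs k : forall r, ~ (0 <= r <= 1) -> h_ k r = 0.
  by have [] := K_L2 (Kh k).
have h0 k r : 0 <= h_ k r by have [_ + _ _] := K_L2 (Kh k); exact.
have hfast k : (\int[mu]_r (`|h_ k.+1 r - h_ k r|)%:E <= (9 / 2 * 2^-1 ^+ k)%:E)%E.
  (* With this choice [c / 2 + 8 e k / (2 c) = 9 / 2 * 2 ^- k]. *)
  pose c : R := 2^-1 ^+ k.
  have c0 : 0 < c by rewrite exprn_gt0.
  have ec : e k = c * c.
    by rewrite /e /c -exprMn; congr (_ ^+ _); field.
  apply: le_trans (@integral_norm_supported_le_sq R (fun r => h_ k.+1 r - h_ k r) c _ _ c0) _.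
  - exact: measurable_funB.
  - by move=> r r01; rewrite !hs// subrr.
  apply: (@le_trans _ _ ((c / 2)%:E + ((2 * c)^-1)%:E * (8 * e k)%:E)%E).
    by rewrite leeD2l// lee_wpmul2l// lee_fin invr_ge0 mulr_ge0// ltW.
  rewrite -EFinM -EFinD lee_fin le_eqVlt; apply/orP; left; apply/eqP.
  by rewrite ec -/c; field; rewrite gt_eqF.
have c0 : 0 <= 9 / 2 :> R by [].
have [g [intg g0 hg primg]] := fast_cauchy_cvg c0
  (fun k => unit_L2_integrable (K_L2 (Kh k))) h0 hfast.
exists g, h_; split => //.
apply: (@le_trans _ _ d%:E); last by rewrite lee_fin d_le_b.
apply: (@sq_int_fatou _ h_ g d (fun k => d + e k)) => //.
- exact: integrable_measurable_fun intg.
- by move=> k; have [n [_ Kn _]] := hP k; rewrite -lee_fin (NE Kn).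
rewrite -[X in _ --> X]addr0; apply: (@cvgD _ R); first exact: cvg_cst.
by apply: cvg_expr; rewrite ger0_norm// invf_lt1// ltr1n.
Qed.

End minimal_norm.

(** * Extraction of subsequences *)

Section subsequences.
Context {T : choiceType} (s : topology_on T).
Implicit Types (u v : nat -> T) (l : T) (phi : nat -> nat).

Lemma increasing_seq_ge phi : increasing_seq phi -> forall n, (n <= phi n)%N.
Proof.
move=> /increasing_seqP phiS; elim=> [//|n IH].
exact: leq_ltn_trans IH (phiS n).
Qed.

Lemma increasing_seq_comp phi psi :
  increasing_seq phi -> increasing_seq psi -> increasing_seq (phi \o psi).
Proof. by move=> iphi ipsi m n /=; rewrite iphi; exact: ipsi. Qed.

(** The diagonal sequence inherits convergence in this way: from some rank on it
    consists of terms of a given subsequence, with indices that tend to infinity. *)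
Lemma cvg_in_reindex u v l (N : nat) : cvg_in s u l ->
  (forall n, (N <= n)%N -> exists2 k, (n <= k)%N & v n = u k) -> cvg_in s v l.
Proof.
move=> ul vu A /ul [M _ MA]; exists (maxn N M) => // n /=.
rewrite geq_max => /andP[Nn Mn]; have [k nk ->] := vu n Nn.
by apply: MA => /=; exact: leq_trans nk.
Qed.

Lemma cvg_in_subseq u l phi : increasing_seq phi ->
  cvg_in s u l -> cvg_in s (u \o phi) l.
Proof.
move=> iphi ul; apply: (@cvg_in_reindex u _ _ 0%N) => // n _.
by exists (phi n) => //; exact: increasing_seq_ge.
Qed.

Lemma cvg_in_cst l : cvg_in s (fun=> l) l.
Proof. exact: cvg_cst. Qed.

(** Were [u] to leave a neighbourhood of [l] infinitely often, the subsequence of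
    these terms would have no subsequence converging to [l]. *)
Lemma cvg_in_subsubseq u l : (forall phi, increasing_seq phi ->
    exists2 psi, increasing_seq psi & cvg_in s (u \o phi \o psi) l) ->
  cvg_in s u l.
Proof.
move=> H; apply: contrapT => /existsNP[A /not_implyP[lA nA]].
have far N : exists n, (N <= n)%N /\ ~ A (u n).
  apply: contrapT => /forallNP far; apply: nA; exists N => // n /= Nn.
  by apply: contrapT => nAn; apply: (far n).
have /(_ _)/cid-/all_sig[f fP] := far.
pose phi := fix phi n := if n is n'.+1 then f (phi n').+1 else f 0%N.
have iphi : increasing_seq phi.
  by apply/increasing_seqP => n; have [lt_phi _] := fP (phi n).+1; exact: lt_phi.
have phiA n : ~ A (u (phi n)) by case: n => [|n]; [case: (fP 0%N)|case: (fP (phi n).+1)].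
have [psi ipsi /(_ A lA)[M _ MA]] := H phi iphi.
exact: (phiA (psi M) (MA M (leqnn M))).
Qed.

(** From index [q] on, the diagonal sequence consists of terms of the q-th nested
    subsequence, and the n-th one comes with an index at least [n] in it. *)
Lemma diagonal_subsequence (v : nat -> nat -> T) :
  (forall q phi, increasing_seq phi -> exists psi l,
     increasing_seq psi /\ cvg_in s (v q \o phi \o psi) l) ->
  exists2 phi, increasing_seq phi & forall q, exists l, cvg_in s (v q \o phi) l.
Proof.
move=> H.
have H' (q : nat) (phi : {phi | increasing_seq phi}) : exists psi,
    increasing_seq psi /\ exists l, cvg_in s (v q \o sval phi \o psi) l.
  case: phi => phi iphi; have [psi [l [ipsi psil]]] := H q _ iphi.
  by exists psi; split; last exists l.
have /(_ _ _)/cid-H2 := H'.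
pose ext q p := sval (H2 q p).
have iext q p : increasing_seq (ext q p) by case: (svalP (H2 q p)).
have extl q p : exists l, cvg_in s (v q \o sval p \o ext q p) l.
  by case: (svalP (H2 q p)).
have iid : increasing_seq (@id nat) by move=> m n.
(* The nested subsequences carry their monotonicity, which the next
   extraction needs. *)
pose Psi := fix Psi q : {phi | increasing_seq phi} :=
  if q is q'.+1 then
    exist _ (sval (Psi q') \o ext q' (Psi q'))
      (increasing_seq_comp (svalP (Psi q')) (iext q' (Psi q')))
  else exist _ id iid.
pose psi q := sval (Psi q).
have ipsi q : increasing_seq (psi q) by exact: (svalP (Psi q)).
have psiS q n : psi q.+1 n = psi q (ext q (Psi q) n) by [].
have psi_sub q n j : exists2 k, (n <= k)%N & psi (q + j)%N n = psi q k.
  elim: j n => [|j IH] n; first by exists n; rewrite ?addn0.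
  rewrite addnS psiS; have [k nk ->] := IH (ext (q + j)%N (Psi (q + j)%N) n).
  by exists k => //; apply: leq_trans nk; exact: increasing_seq_ge.
exists (fun n => psi n n).
  apply/increasing_seqP => n; rewrite psiS.
  have : (n < ext n (Psi n) n.+1)%N by exact: increasing_seq_ge.
  by rewrite -[(n < _)%N](leW_mono (ipsi n)).
move=> q; have [l ql] := extl q (Psi q); exists l.
apply: (@cvg_in_reindex _ _ _ q.+1 ql) => n qn.
have [k nk kE] := psi_sub q.+1 n (n - q.+1)%N; exists k => //=.
by move: kE; rewrite subnKC// => ->.
Qed.

End subsequences.

(** * Curves of bounded action *)

Section finite_action.
Context {R : realType} {X : metricType R}.
Local Notation mu := (@lebesgue_measure R).
Implicit Types (g : R -> X).

Lemma finite_action_abs_cont g : (action g < +oo)%E -> abs_cont 0 1 g.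
Proof. by rewrite /action; case: asboolP. Qed.

Lemma integrable_restrict_unit (m : R -> R) :
  mu.-integrable setT (EFin \o m) -> mu.-integrable setT (EFin \o (m \_ `[0, 1])).
Proof.
move=> intm; rewrite -restrict_EFin; apply/(integrable_mkcond _ _).1 => //.
exact: integrable_in.
Qed.

Lemma finite_action_speed g (a : R) : (action g <= a%:E)%E ->
  exists m, [/\ dominates_speed m g, unit_L2 m & (sq_int m <= (2 * a)%:E)%E].
Proof.
move=> ga.
have acg : abs_cont 0 1 g.
  by apply: finite_action_abs_cont; apply: le_lt_trans ga _; exact: ltry.
have [m [intm m0 mg] gm] := abs_cont_action acg.
have intm' := integrable_restrict_unit intm.
have sqE : sq_int (m \_ `[0, 1]) = sq_int m.
  by apply: eq_integral => t t01; rewrite /patch t01.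
have sqa : (sq_int m <= (2 * a)%:E)%E.
  rewrite EFinM -lee_pdivrMl//.
  by rewrite -gm.
exists (m \_ `[0, 1]); split; last by rewrite sqE.
- split => //.
    by move=> r; rewrite /patch; case: ifP.
  move=> s t s0 st t1; apply: (le_trans (mg s t s0 st t1)).
  rewrite !primitiveB_cc// le_eqVlt; apply/orP; left; apply/eqP.
  apply: eq_Rintegral => r; rewrite inE/= in_itv/= => /andP[sr rt].
  by rewrite /patch mem_set//= in_itv/= (le_trans s0 sr) (le_trans rt t1).
split.
- exact: integrable_measurable_fun intm'.
- by move=> r; rewrite /patch; case: ifP.
- move=> r r01; rewrite /patch memNset//= in_itv/=; exact/negP.
- by rewrite sqE; apply: le_lt_trans sqa _; exact: ltry.
Qed.

(** The bound by [c / 2 * (t - s) + a / c], valid for all [c > 0], replaces the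
    Hoelder bound [sqrt (2 * a * (t - s))]. *)
Lemma finite_action_modulus g (a c s t : R) : (action g <= a%:E)%E -> 0 < c ->
  0 <= s -> s <= t -> t <= 1 ->
  mdist (g s) (g t) <= c / 2 * (t - s) + a / c.
Proof.
move=> /finite_action_speed[m [[intm m0 mg] mL2 ma]] c0 s0 st t1.
have [mm _ _ _] := mL2.
apply: (le_trans (mg s t s0 st t1)).
rewrite -lee_fin primitiveB_ccE//.
have sub : `[s, t] `<=` `[0, 1]%classic.
  by move=> r /=; rewrite !in_itv/= => /andP[sr rt]; rewrite (le_trans s0)//= (le_trans rt).
have -> : (\int[mu]_(r in `[s, t]) (m r)%:E = \int[mu]_(r in `[s, t]) (`|m r|)%:E)%E.
  by apply: eq_integral => r _; rewrite ger0_norm.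
apply: (le_trans (integral_norm_le_sq mm c0 (measurable_itv _) sub)).
rewrite EFinD; apply: leeD.
  rewrite [leRHS]EFinM /= lebesgue_measure_itv/=; case: ifPn => [_|]; first by rewrite -EFinB.
  rewrite lte_fin -leNgt => ts; rewrite mule0 -EFinM lee_fin.
  by rewrite mulr_ge0 ?subr_ge0// divr_ge0// ltW.
apply: (@le_trans _ _ (((2 * c)^-1)%:E * (2 * a)%:E)%E).
  by rewrite lee_wpmul2l// lee_fin invr_ge0 mulr_ge0// ltW.
by rewrite -EFinM lee_fin le_eqVlt; apply/orP; left; apply/eqP; field; rewrite gt_eqF.
Qed.

Lemma clamp_nd (s t : R) : s <= t -> clamp s <= clamp t <= clamp s + (t - s).
Proof.
by move=> st; apply/andP; split; rewrite /clamp /Num.max /Num.min;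
  do ! case: ifPn; rewrite -?leNgt; lra.
Qed.

(** Take [c = 2 (`|a| + 1) / e] in the previous bound: then [a / c <= e / 2], and
    [c / 2 * (t - s)] is at most [e / 2] when [t - s] is at most [e / c]. *)
Lemma finite_action_equicontinuous (a e : R) : 0 < e -> exists2 d, 0 < d &
  forall g, (action g <= a%:E)%E -> forall s t, `|s - t| < d ->
    mdist (g (clamp s)) (g (clamp t)) <= e.
Proof.
move=> e0; pose a' := `|a| + 1; have a'0 : 0 < a' by rewrite ltr_wpDl.
pose c := 2 * a' / e; have c0 : 0 < c by rewrite divr_gt0// mulr_gt0.
exists (e / c); first by rewrite divr_gt0.
move=> g ga; suff key s t : s <= t -> t - s < e / c ->
    mdist (g (clamp s)) (g (clamp t)) <= e.
  move=> s t std; have [st|/ltW ts] := leP s t.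
    by apply: key => //; apply: le_lt_trans std; rewrite distrC ler_norm.
  by rewrite metric_sym; apply: key => //; apply: le_lt_trans std; rewrite ler_norm.
move=> st std; have /andP[c1 c2] := clamp_nd st.
have /andP[cs0 _] := clamp_itv s; have /andP[_ ct1] := clamp_itv t.
apply: (le_trans (finite_action_modulus ga c0 cs0 c1 ct1)).
have -> : e = e / 2 + e / 2 by field.
apply: lerD.
  apply: (@le_trans _ _ (c / 2 * (e / c))).
    rewrite ler_wpM2l ?divr_ge0 ?(ltW c0)//; move: std c2; lra.
  by rewrite le_eqVlt; apply/orP; left; apply/eqP; field; rewrite gt_eqF.
rewrite ler_pdivrMr//.
have -> : e / 2 * c = a' by rewrite /c; field; rewrite gt_eqF.
by rewrite (le_trans (ler_norm a))// lerDl.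
Qed.

End finite_action.

Section limit_curve.
Context {R : realType} {X : metricType R} (sigma : topology_on X).
Hypothesis bounded_subseq : forall u : nat -> X, metric_bounded (range u) ->
  exists phi : nat -> nat, exists l : X,
    increasing_seq phi /\ cvg_in sigma (u \o phi) l.
Hypothesis mdist_lsc : forall (u v : nat -> X) x y,
  cvg_in sigma u x -> cvg_in sigma v y ->
  ((mdist x y)%:E <= limn_einf (fun n => (mdist (u n) (v n))%:E))%E.

Lemma mdist_limit_le (u v : nat -> X) x y (e : R) :
  cvg_in sigma u x -> cvg_in sigma v y ->
  (forall n, mdist (u n) (v n) <= e) -> mdist x y <= e.
Proof.
move=> ux vy uve; rewrite -lee_fin; apply: (le_trans (mdist_lsc ux vy)).
by apply: (@limn_einf_le_cvg _ _ (cst e%:E)) => //; exact: cvg_cst.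
Qed.

Lemma rational_dense_unit (t d : R) : 0 < d ->
  exists q, `|@rational_seq R q - t| < d.
Proof.
move=> d0; have [|q /andP[q1 q2]] := @rational_seq_dense R (t - d) (t + d).
  by rewrite ltrBlDr -addrA ltrDl addr_gt0.
by exists q; rewrite ltr_distl q1 q2.
Qed.

(** At any time [t], two subsequential limits are close to the limit at a nearby
    rational time, by equicontinuity and lower semicontinuity of the distance.
    They are therefore equal, and the whole extracted sequence converges at [t]. *)
Lemma limit_curve (gam : nat -> R -> X) (a : R) (x : X) :
  (forall n, (action (gam n) <= a%:E)%E) -> (forall n, gam n 0 = x) ->
  exists2 phi : nat -> nat, increasing_seq phi &
    exists w : R -> X, forall t,
      cvg_in sigma (fun n => gam (phi n) (clamp t)) (w t).
Proof.
move=> ga gx.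
have bdd (u : nat -> nat) t : metric_bounded (range (fun n => gam (u n) (clamp t))).
  exists (2 * (1 / 2 * (clamp t - 0) + a / 1)) => _ _ [n _ <-] [m _ <-].
  have /andP[t0 t1] := clamp_itv t.
  have H k := finite_action_modulus (ga k) ltr01 (lexx 0) t0 t1.
  have := metric_triangle (gam (u n) (clamp t)) x (gam (u m) (clamp t)).
  have := H (u n); have := H (u m); rewrite !gx.
  rewrite (metric_sym (gam (u n) (clamp t)) x); lra.
have [phi iphi phiq] := @diagonal_subsequence _ sigma
    (fun q n => gam n (clamp (@rational_seq R q)))
    (fun q p _ => bounded_subseq (bdd p (@rational_seq R q))).
exists phi => //.
suff H t : exists l, cvg_in sigma (fun n => gam (phi n) (clamp t)) l.
  by have /(_ _)/cid-/all_sig[w wP] := H; exists w.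
have uniq (p1 p2 : nat -> nat) l1 l2 : increasing_seq p1 -> increasing_seq p2 ->
    cvg_in sigma ((fun n => gam (phi n) (clamp t)) \o p1) l1 ->
    cvg_in sigma ((fun n => gam (phi n) (clamp t)) \o p2) l2 -> l1 = l2.
  move=> ip1 ip2 cl1 cl2; apply: mdist_positivity; apply/eqP.
  rewrite eq_le mdist_ge0 andbT; apply/ler_addgt0Pl => e e0; rewrite addr0.
  have e20 : 0 < e / 2 by rewrite divr_gt0.
  have [d d0 dP] := finite_action_equicontinuous (X := X) a e20.
  have [q qt] := rational_dense_unit t d0.
  have [lq lqP] := phiq q.
  have H (p : nat -> nat) l : increasing_seq p ->
      cvg_in sigma ((fun n => gam (phi n) (clamp t)) \o p) l -> mdist lq l <= e / 2.
    move=> ip cl; apply: (mdist_limit_le (cvg_in_subseq ip lqP) cl) => n /=.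
    exact: dP.
  have := H _ _ ip1 cl1; have := H _ _ ip2 cl2.
  have := metric_triangle l1 lq l2; rewrite (metric_sym l1 lq); lra.
have [p [l [ip pl]]] := bounded_subseq (bdd phi t).
exists l; apply: cvg_in_subsubseq => p' ip'.
have [p'' [l' [ip'' pl']]] := bounded_subseq (bdd (phi \o p') t).
exists p'' => //.
by rewrite (uniq p (p' \o p'') l l' ip (increasing_seq_comp ip' ip'') pl pl').
Qed.

End limit_curve.

(** * Lower semicontinuity of the action *)

Section action_lsc.
Context {R : realType} {X : metricType R} (sigma : topology_on X).
Local Notation mu := (@lebesgue_measure R).
Hypothesis mdist_lsc : forall (u v : nat -> X) x y,
  cvg_in sigma u x -> cvg_in sigma v y ->
  ((mdist x y)%:E <= limn_einf (fun n => (mdist (u n) (v n))%:E))%E.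

Lemma primitive_midpoint (h k : R -> R) t : mu.-integrable setT (EFin \o h) ->
  mu.-integrable setT (EFin \o k) ->
  primitive (fun r => (h r + k r) / 2) t = (primitive h t + primitive k t) / 2.
Proof.
move=> inth intk; rewrite /primitive RintegralZr//.
  by rewrite RintegralD//; exact: integrable_in.
have -> : EFin \o (fun r => h r + k r) = ((EFin \o h) \+ (EFin \o k))%E by [].
by apply: integrableD => //; exact: integrable_in.
Qed.

Lemma unit_L2_midpoint (h k : R -> R) : unit_L2 h -> unit_L2 k ->
  unit_L2 (fun r => (h r + k r) / 2).
Proof.
move=> [mh h0 hs hoo] [mk k0 ks koo]; split.
- by apply: measurable_funM => //; exact: measurable_funD.
- by move=> r; rewrite divr_ge0// addr_ge0.
- by move=> r r01; rewrite hs// ks// addr0 mul0r.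
have := parallelogram mh mk => par.
have : (4%:E * sq_int (fun r => (h r + k r) / 2)%R < +oo)%E.
  apply: (@le_lt_trans _ _ (2%:E * sq_int h + 2%:E * sq_int k)%E).
    by rewrite -par leeDr// ge0_sq_int.
  by rewrite lte_add_pinfty// lte_mul_pinfty.
apply: contraTT; rewrite -!leNgt !leye_eq => /eqP ->.
by rewrite mulry gtr0_sg// mul1e.
Qed.

(** The sets [K n] below contain the speeds of the curves [gam k] for [k >= n], so
    they have elements of squared norm close to [2 * a]. A bound valid for almost
    all [gam k] is inherited by the limit [h] of almost minimal elements, and
    lower semicontinuity turns it into a bound for the limit curve. *)
Lemma action_lsc (gam : nat -> R -> X) (w : R -> X) (a : R) (a_ : nat -> R) :
  (forall n, (action (gam n) <= (a_ n)%:E)%E) -> a_ n @[n --> \oo] --> a ->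
  (forall t, 0 <= t <= 1 -> cvg_in sigma (fun n => gam n t) (w t)) ->
  exists2 h, dominates_speed h w & (sq_int h <= (2 * a)%:E)%E.
Proof.
move=> gama aa gamw.
pose K n : set (R -> R) := [set h | unit_L2 h /\ forall s t c,
  0 <= s -> s <= t -> t <= 1 ->
  (forall k, (n <= k)%N -> c <= mdist (gam k s) (gam k t)) ->
  c <= primitive h t - primitive h s].
have [h [h_ [inth h0 hL2 Kh hlim]]] : exists h (h_ : nat -> R -> R),
  [/\ mu.-integrable setT (EFin \o h), forall r, 0 <= h r,
    (sq_int h <= (2 * a)%:E)%E, forall k, K k (h_ k) &
    forall t, primitive (h_ k) t @[k --> \oo] --> primitive h t].
  apply: minimal_norm_limit.
  - by move=> n h [].
  - move=> n h [hL2 hn]; split => // s t c s0 st t1 ck.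
    by apply: hn => // k nk; apply: ck; exact: ltnW.
  - move=> n h k [hL2 hn] [kL2 kn]; split; first exact: unit_L2_midpoint.
    move=> s t c s0 st t1 ck.
    have inth := unit_L2_integrable hL2; have intk := unit_L2_integrable kL2.
    rewrite !primitive_midpoint//.
    by have := hn s t c s0 st t1 ck; have := kn s t c s0 st t1 ck; lra.
  - move=> n e e0.
    have e20 : 0 < e / 2 by rewrite divr_gt0.
    move/(@cvgrPdist_le _ R) : aa => /(_ _ e20)[N _ Na].
    pose k := maxn n N.
    have [m [[intm m0 mg] mL2 ma]] := finite_action_speed (gama k).
    exists m.
      split => // s t c s0 st t1 ck; apply: le_trans (mg s t s0 st t1).
      by apply: ck; exact: leq_maxl.
    apply: (le_trans ma); rewrite lee_fin.
    have := Na k (leq_maxr _ _); rewrite ler_norml => /andP[+ _].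
    by lra.
exists h => //; split => // s t s0 st t1.
rewrite leNgt; apply/negP => lt_h.
pose c := (mdist (w s) (w t) + (primitive h t - primitive h s)) / 2.
have cw : c < mdist (w s) (w t) by rewrite /c; move: lt_h; lra.
have ch : primitive h t - primitive h s < c by rewrite /c; move: lt_h; lra.
have [N _ NC] : \forall n \near \oo, (c%:E < (mdist (gam n s) (gam n t))%:E)%E.
  apply: limn_einf_gt; apply: lt_le_trans (mdist_lsc (gamw s _) (gamw t _)).
  - by rewrite lte_fin.
  - by rewrite s0 (le_trans st t1).
  - by rewrite (le_trans s0 st) t1.
have : c <= primitive h t - primitive h s.
  apply: (cvgr_to_ge (cvgB (hlim t) (hlim s))).
  exists N => // k /= Nk; have [_ hk] := Kh k; apply: hk => // j kj.
  by rewrite -lee_fin ltW// NC//=; exact: leq_trans kj.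
by rewrite leNgt ch.
Qed.

End action_lsc.

(** * Lower semicontinuity of the slope and of the Fisher information *)

Section fisher_lsc.
Context {R : realType} {X : metricType R} (sigma : topology_on X).
Variable E : X -> \bar R.
Local Notation mu := (@lebesgue_measure R).
Hypothesis bounded_subseq : forall u : nat -> X, metric_bounded (range u) ->
  exists phi : nat -> nat, exists l : X,
    increasing_seq phi /\ cvg_in sigma (u \o phi) l.
Hypothesis mdist_lsc : forall (u v : nat -> X) x y,
  cvg_in sigma u x -> cvg_in sigma v y ->
  ((mdist x y)%:E <= limn_einf (fun n => (mdist (u n) (v n))%:E))%E.
Hypothesis slope_sigma_lsc : forall (u : nat -> X) x, cvg_in sigma u x ->
  (slope E x <= limn_einf (fun n => slope E (u n)))%E.

Lemma slope_ge0 x : (0 <= slope E x)%E.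
Proof.
rewrite /slope; case: ifP => // _; case: asboolP => // nix.
apply: limf_esup_ge0.
  move=> x0; apply: nix; split; first by rewrite inE.
  exists [set y | ~ (y != x)].
    exact: x0.
  apply/seteqP; split => [y [/= /negP/negPn/eqP-> _]//|y /= ->].
  by split => //; rewrite eqxx.
move=> z; rewrite mule_ge0//; first by rewrite le_max lexx orbT.
by rewrite lee_fin invr_ge0 mdist_ge0.
Qed.

(** A sequence converging to [x] for the distance is bounded, so it has a
    subsequence converging for [sigma]; lower semicontinuity of the distance
    identifies its limit as [x]. *)
Lemma slope_lsc : lower_semicontinuous (slope E).
Proof.
move=> x a ax; apply: contrapT => nV.
have H n : exists y, mdist x y < n.+1%:R^-1 /\ (slope E y <= a%:E)%E.
  apply: contrapT => /forallNP ny; apply: nV.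
  exists (ball x n.+1%:R^-1); first by apply: nbhsx_ballx; rewrite invr_gt0.
  move=> y; rewrite ballEmdist/= => xy; rewrite ltNge; apply/negP => ya.
  by apply: (ny y).
have /(_ _)/cid-/all_sig[u uP] := H.
have uB : metric_bounded (range u).
  exists 2 => _ _ [n _ <-] [m _ <-].
  have xn k : mdist x (u k) <= 1.
    have [/ltW xk _] := uP k; rewrite (le_trans xk)// invf_le1// ler1n//.
  have := metric_triangle (u n) x (u m); have := xn n; have := xn m.
  rewrite (metric_sym (u n) x); lra.
have [phi [l [iphi ul]]] := bounded_subseq uB.
have xl : x = l.
  apply: mdist_positivity; apply/eqP; rewrite eq_le mdist_ge0 andbT -lee_fin.
  apply: (le_trans (mdist_lsc (@cvg_in_cst _ sigma x) ul)).
  apply: (@limn_einf_le_cvg _ _ (fun n => (n.+1%:R^-1)%:E)).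
    move=> n; rewrite lee_fin; have [/ltW xk _] := uP (phi n).
    rewrite (le_trans xk)// lef_pV2 ?posrE// ler_nat ltnS.
    exact: increasing_seq_ge.
  apply/cvg_EFin; [exact: nearW|exact: cvg_harmonic].
move: ax; rewrite xl ltNge => /negP; apply.
apply: (le_trans (slope_sigma_lsc ul)).
apply: (@limn_einf_le_cvg _ _ (cst a%:E)); last exact: cvg_cst.
by move=> n; have [_] := uP (phi n).
Qed.

Lemma measurable_slope_curve (g : R -> X) (A : set R) : continuous g ->
  measurable_fun A (slope E \o g).
Proof.
move=> cg; apply: measurable_funTS; apply: lower_semicontinuous_measurable.
apply/lower_semicontinuousP => a.
have /lower_semicontinuousP/(_ a) oE := slope_lsc.
by apply: (@open_comp _ _ g _ _ oE) => t _; exact: cg.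
Qed.

(** The square of the infimum of a tail is at most the infimum of the squares, and
    multiplication is continuous on nonnegative extended reals away from
    [0 * +oo]. *)
Lemma sqr_limn_einf_le (u : (\bar R)^nat) (x : \bar R) :
  (forall n, (0 <= u n)%E) -> (0 <= x)%E -> (x <= limn_einf u)%E ->
  (x ^+ 2 <= limn_einf (fun n => u n ^+ 2))%E.
Proof.
move=> u0 x0 xu; rewrite expe2.
apply: (@le_trans _ _ (limn_einf u * limn_einf u)%E); first exact: lee_pmul.
have e0 n : (0 <= einfs u n)%E.
  by apply: le_ereal_inf_tmp => _ [k _ <-]; exact: u0.
have eu : (einfs u n @[n --> \oo] --> limn_einf u)%E.
  by rewrite limn_einf_lim; exact: is_cvg_einfs.
have euu : ((einfs u n * einfs u n)%E @[n --> \oo] --> (limn_einf u * limn_einf u)%E).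
  apply: cvgeM => //.
  by move: (le_trans x0 xu); case: (limn_einf u) => [r| |] // _; rewrite mule_def_fin.
rewrite -(cvg_lim _ euu)//; rewrite [leRHS]limn_einf_lim.
apply: lee_lim; [by apply/cvg_ex; eexists; exact: euu|exact: is_cvg_einfs|].
apply: nearW => n; apply: le_ereal_inf_tmp => _ [k nk <-].
have ek : (einfs u n <= u k)%E by apply: ereal_inf_lbound; exists k.
by rewrite expe2; exact: lee_pmul.
Qed.

(** Fatou's lemma, with measurability along each [gam n] from the lower
    semicontinuity of the slope. *)
Lemma fisher_lsc (gam : nat -> R -> X) (w : R -> X) (b : R) (b_ : nat -> R) :
  (forall n, (fisher E (gam n) <= (b_ n)%:E)%E) -> b_ n @[n --> \oo] --> b ->
  (forall n, continuous (gam n \o clamp)) ->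
  (forall t, 0 <= t <= 1 -> cvg_in sigma (fun n => gam n t) (w t)) ->
  (fisher E w <= b%:E)%E.
Proof.
move=> gamb bb cgam gamw.
have sq0 x : (0 <= slope E x ^+ 2)%E by rewrite expe2 mule_ge0// slope_ge0.
rewrite /fisher lee_pdivrMl//.
apply: (@le_trans _ _ (\int[mu]_(t in `[0%R, 1%R])
    limn_einf (fun n => slope E (gam n t) ^+ 2))%E).
  apply: ge0_le_integral_lower => t; first by move=> _; exact: sq0.
  rewrite /= in_itv/= => t01; apply: sqr_limn_einf_le.
  - by move=> n; exact: slope_ge0.
  - exact: slope_ge0.
  - exact: slope_sigma_lsc (gamw t t01).
apply: (@le_trans _ _ (limn_einf (fun n =>
    \int[mu]_(t in `[0%R, 1%R]) (slope E (gam n t) ^+ 2)))%E).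
  apply: fatou => //.
  move=> n; apply: (eq_measurable_fun (fun t => (slope E \o (gam n \o clamp)) t *
      (slope E \o (gam n \o clamp)) t)%E).
    by move=> t; rewrite inE/= in_itv/= => t01; rewrite clamp_id// expe2.
  by apply: emeasurable_funM; exact: measurable_slope_curve (cgam n).
apply: (@limn_einf_le_cvg _ _ (fun n => (2 * b_ n)%:E)).
  by move=> n; rewrite EFinM -lee_pdivrMl//; exact: gamb.
rewrite -EFinM; apply/cvg_EFin; first exact: nearW.
exact: (cvgM (cvg_cst _) bb).
Qed.

End fisher_lsc.

(** * Right derivatives of infima of affine functions *)

Section infimum_of_affine.
Context {R : realType}.
Variables (Q : set (R * R)) (G : R -> R) (L : R).
Hypothesis Q_ge0 : forall p, Q p -> 0 <= p.2.
Hypothesis G_le : forall p s, Q p -> 0 <= s -> G s <= p.1 + s * p.2.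
Hypothesis G_inf : forall s e, 0 <= s -> 0 < e ->
  exists2 p, Q p & p.1 + s * p.2 < G s + e.
Hypothesis G_slope0 : forall s, 0 <= s -> G s <= G 0 + s * L.

(** Concavity without division: evaluate all three points on an affine function
    that almost attains the infimum at [u]. *)
Lemma affine_inf_concave s u v : 0 <= s -> s < u -> u < v ->
  (v - u) * G s + (u - s) * G v <= (v - s) * G u.
Proof.
move=> s0 su uv; apply/ler_addgt0Pr => e e0.
have vs0 : 0 < v - s by rewrite subr_gt0 (lt_trans su).
have [//||p Qp pu] := @G_inf u (e / (v - s)).
- by rewrite (le_trans s0)// ltW.
- by rewrite divr_gt0.
have ps := G_le Qp s0.
have pv : G v <= p.1 + v * p.2.
  by apply: G_le => //; rewrite (le_trans s0)// ltW// (lt_trans su).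
apply: (@le_trans _ _ ((v - u) * (p.1 + s * p.2) + (u - s) * (p.1 + v * p.2))).
  by apply: lerD; rewrite ler_wpM2l// subr_ge0 ltW.
have -> : (v - u) * (p.1 + s * p.2) + (u - s) * (p.1 + v * p.2) =
  (v - s) * (p.1 + u * p.2) by ring.
have -> : (v - s) * G u + e = (v - s) * (G u + e / (v - s)).
  by field; rewrite gt_eqF.
by rewrite ler_wpM2l// ltW.
Qed.

Lemma affine_inf_nd s u : 0 <= s -> s <= u -> G s <= G u.
Proof.
move=> s0 su; apply/ler_addgt0Pr => e e0.
have [p Qp pu] := G_inf (le_trans s0 su) e0.
apply: le_trans (ltW pu); apply: (le_trans (G_le Qp s0)).
by rewrite lerD2l ler_wpM2r// Q_ge0.
Qed.

(** The slopes of a concave function decrease, so the bound at the origin is a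
    bound everywhere. *)
Lemma affine_inf_lipschitz s u : 0 <= s -> s <= u -> G u - G s <= L * (u - s).
Proof.
move=> s0; rewrite le_eqVlt => /predU1P[->|su]; first by rewrite !subrr mulr0.
have u0 : 0 < u by rewrite (le_lt_trans s0).
move: s0; rewrite le_eqVlt => /predU1P[<-|s0].
  by have := G_slope0 (ltW u0); lra.
have H1 := affine_inf_concave (lexx 0) s0 su.
have us0 : 0 <= u - s by rewrite subr_ge0 ltW.
have H2 := ler_wpM2l us0 (G_slope0 (ltW s0)).
by rewrite -(ler_pM2l s0); move: H1 H2; lra.
Qed.

Lemma right_quotient_ge0 s h : 0 <= s -> 0 < h -> 0 <= right_quotient G s h.
Proof.
move=> s0 h0; rewrite /right_quotient mulr_ge0 ?invr_ge0 ?(ltW h0)// subr_ge0.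
by apply: affine_inf_nd => //; rewrite lerDl ltW.
Qed.

Lemma right_quotient_le s h : 0 <= s -> 0 < h -> right_quotient G s h <= L.
Proof.
move=> s0 h0; rewrite /right_quotient ler_pdivrMl// mulrC.
have := @affine_inf_lipschitz s (s + h) s0.
by rewrite lerDl (ltW h0) => /(_ erefl); lra.
Qed.

Lemma right_quotient_ni s h k : 0 <= s -> 0 < h -> h <= k ->
  right_quotient G s k <= right_quotient G s h.
Proof.
move=> s0 h0; rewrite le_eqVlt => /predU1P[->//|hk].
have k0 := lt_trans h0 hk.
have := @affine_inf_concave s (s + h) (s + k) s0.
rewrite ltrDl h0 ltrD2l => /(_ erefl hk).
rewrite /right_quotient ler_pdivrMl// mulrCA ler_pdivlMl//.
by lra.
Qed.

(** Increments of a concave function over intervals of fixed length decrease: add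
    the concavity inequalities at [t] and at [s + h] between [s] and [t + h]. *)
Lemma right_quotient_ni_base s t h : 0 <= s -> s <= t -> 0 < h ->
  right_quotient G t h <= right_quotient G s h.
Proof.
move=> s0; rewrite le_eqVlt => /predU1P[->//|st] h0.
rewrite /right_quotient ler_pM2l ?invr_gt0//.
have T0 : 0 < t + h - s by lra.
have H1 : (t + h - t) * G s + (t - s) * G (t + h) <= (t + h - s) * G t.
  by apply: affine_inf_concave => //; rewrite ltrDl.
have H2 : (t + h - (s + h)) * G s + (s + h - s) * G (t + h) <= (t + h - s) * G (s + h).
  by apply: affine_inf_concave => //; rewrite ?ltrDl// ltrD2r.
rewrite -(ler_pM2l T0); lra.
Qed.

(** Difference quotients increase as the step shrinks, so the right derivative is
    their supremum. *)
Definition right_slope s := sup [set right_quotient G s h | h in [set h : R | 0 < h]].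

Lemma has_sup_right_quotients s : 0 <= s ->
  has_sup [set right_quotient G s h | h in [set h : R | 0 < h]].
Proof.
move=> s0; split; first by exists (right_quotient G s 1), 1 => /=.
by exists L => _ [h h0 <-]; exact: right_quotient_le.
Qed.

Lemma right_quotient_le_right_slope s h : 0 <= s -> 0 < h ->
  right_quotient G s h <= right_slope s.
Proof.
by move=> s0 h0; apply: ub_le_sup; [case: (has_sup_right_quotients s0)|exists h].
Qed.

Lemma right_slope_cvg s : 0 <= s -> right_quotient G s h @[h --> 0^'+] --> right_slope s.
Proof.
move=> s0; apply/(@cvgrPdist_le _ R) => e e0.
have [_ [h h0 <-] hD] := sup_adherent e0 (has_sup_right_quotients s0).
near=> k.
have k0 : 0 < k by near: k; exact: nbhs_right_gt.
have kh : k <= h by near: k; exact: nbhs_right_le.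
have := right_quotient_le_right_slope s0 k0; have := right_quotient_ni s0 k0 kh.
rewrite -/(right_slope s) in hD.
by move=> ? ?; rewrite ger0_norm ?subr_ge0//; move: hD; lra.
Unshelve. all: by end_near. Qed.

Lemma right_slope_bounds s : 0 <= s -> 0 <= right_slope s <= L.
Proof.
move=> s0; apply/andP; split.
  by apply: le_trans (right_quotient_le_right_slope s0 ltr01); exact: right_quotient_ge0.
apply: ge_sup; first by case: (has_sup_right_quotients s0).
by move=> _ [h h0 <-]; exact: right_quotient_le.
Qed.

(** The right derivative decreases, which is one half. For the other, [right_slope t]
    is at least the quotient at [t] for a fixed step [h], which tends to the
    quotient at [s] because [G] is Lipschitz, and the latter is close to
    [right_slope s] for small [h]. *)
Lemma right_slope_right_continuous s : 0 <= s ->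
  right_slope t @[t --> s^'+] --> right_slope s.
Proof.
move=> s0; apply/(@cvgrPdist_le _ R) => e e0.
have L0 : 0 <= L by have /andP[/le_trans + /[dup] H] := right_slope_bounds s0; apply.
have e20 : 0 < e / 2 by rewrite divr_gt0.
have [_ [h h0 <-] hD] := sup_adherent e20 (has_sup_right_quotients s0).
rewrite -/(right_slope s) in hD.
(* For [t] within [d] of [s] the quotients with step [h] differ by at most
   [e / 2]. *)
pose d := h * (e / 2) / (2 * (L + 1)).
have d0 : 0 < d by rewrite divr_gt0// ?mulr_gt0// ltr_wpDl.
near=> t.
have st : s < t by near: t; exact: nbhs_right_gt.
have tsd : t <= s + d by near: t; apply: nbhs_right_le; rewrite ltrDl.
have t0 : 0 <= t by rewrite (le_trans s0)// ltW.
have Dts : right_slope t <= right_slope s.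
  apply: ge_sup; first by case: (has_sup_right_quotients t0).
  move=> _ [k k0 <-]; apply: le_trans (right_quotient_le_right_slope s0 k0).
  exact: right_quotient_ni_base (ltW st) k0.
have H1 : right_quotient G s h - e / 2 <= right_quotient G t h.
  rewrite /right_quotient -(ler_pM2l h0) mulrBr !mulrA mulfV ?gt_eqF// !mul1r.
  have := affine_inf_lipschitz s0 (ltW st).
  have := @affine_inf_nd (s + h) (t + h) (addr_ge0 s0 (ltW h0)).
  rewrite lerD2r => /(_ (ltW st)).
  have : L * (t - s) <= h * e / 2.
    apply: (@le_trans _ _ ((L + 1) * d)).
      apply: ler_pM => //; rewrite ?subr_ge0 ?(ltW st)// ?lerDl//; lra.
    rewrite /d.
    have -> : (L + 1) * (h * (e / 2) / (2 * (L + 1))) = (h * e / 2) / 2.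
      by field; rewrite gt_eqF// ltr_wpDl.
    by rewrite ler_pdivrMr// ler_peMr// ?divr_ge0// ?mulr_ge0// ?ltW// ltr1n.
  by lra.
have := right_quotient_le_right_slope t0 h0.
rewrite ger0_norm ?subr_ge0//; move: hD H1; lra.
Unshelve. all: by end_near. Qed.

End infimum_of_affine.

Section square_reparametrization.
Context {R : realType}.
Variables (G D C : R -> R).
Hypothesis D_cvg : forall s, 0 <= s ->
  right_quotient G s h @[h --> 0^'+] --> D s.
Hypothesis D_rc : forall s, 0 <= s -> D t @[t --> s^'+] --> D s.
Hypothesis CE : forall e, 0 <= e -> C e = G (e ^+ 2).

Lemma sqr_at_right (e : R) : 0 <= e -> t ^+ 2 @[t --> e^'+] --> (e ^+ 2)^'+.
Proof.
move=> e0 A [d /= d0 dA].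
have : \forall t \near e^'+, `|e ^+ 2 - t ^+ 2| < d.
  have : t ^+ 2 @[t --> e^'+] --> e ^+ 2.
    by apply: cvg_within_filter; exact: exprn_continuous.
  by move=> /(@cvgrPdist_lt _ R); apply.
have : \forall t \near e^'+, e < t by exact: nbhs_right_gt.
apply: filterS2 => t et td; apply: dA => //=.
by rewrite ltr_pXn2r// nnegrE ltW// (le_lt_trans e0).
Qed.

(** Chain rule: [(e + h) ^+ 2 = e ^+ 2 + h * (2 * e + h)], and the increment
    [h * (2 * e + h)] tends to [0] from the right, also when [e = 0]. *)
Lemma square_right_quotient_cvg e : 0 <= e ->
  right_quotient C e h @[h --> 0^'+] --> 2 * e * D (e ^+ 2).
Proof.
move=> e0; have e20 : 0 <= e ^+ 2 by rewrite sqr_ge0.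
have kc : h * (2 * e + h) @[h --> 0^'+] --> 0^'+.
  move=> A [d /= d0 dA].
  have : \forall h \near 0^'+, `|0 - h * (2 * e + h)| < d.
    have : h * (2 * e + h) @[h --> (0:R)^'+] --> (0 * (2 * e + 0) : R).
      apply: cvg_within_filter; apply: (@cvgM _ R); first exact: cvg_id.
      by apply: (@cvgD _ R); [exact: cvg_cst|exact: cvg_id].
    by rewrite mul0r => /(@cvgrPdist_lt _ R); apply.
  have : \forall h \near (0:R)^'+, 0 < h by exact: nbhs_right_gt.
  apply: filterS2 => h h0 hd; apply: dA => //=.
  by rewrite mulr_gt0// ltr_wpDl// mulr_ge0.
have lim1 : (2 * e + h) @[h --> 0^'+] --> 2 * e.
  rewrite -[X in _ --> X]addr0; apply: (@cvgD _ R); first exact: cvg_cst.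
  by apply: cvg_within_filter; exact: cvg_id.
have : (2 * e + h) * ((h * (2 * e + h))^-1 *
    (G (e ^+ 2 + h * (2 * e + h)) - G (e ^+ 2))) @[h --> 0^'+]
    --> 2 * e * D (e ^+ 2).
  exact: (cvgM lim1 (cvg_comp _ _ kc (D_cvg e20))).
apply: cvg_trans; apply: near_eq_cvg. 
have : \forall h \near (0:R)^'+, 0 < h by exact: nbhs_right_gt.
apply: filterS => h h0 /=.
rewrite /right_quotient !CE//; last by rewrite addr_ge0// ltW.
have -> : e ^+ 2 + h * (2 * e + h) = (e + h) ^+ 2 by ring.
have h20 : 0 < 2 * e + h by rewrite ltr_wpDl// mulr_ge0.
by field; rewrite !gt_eqF.
Qed.

Lemma square_right_derivable e : 0 <= e -> right_derivable C e.
Proof. by move=> e0; apply/cvg_ex; eexists; exact: square_right_quotient_cvg. Qed.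

Lemma square_right_derive e : 0 <= e -> right_derive C e = 2 * e * D (e ^+ 2).
Proof. by move=> e0; apply: cvg_lim => //; exact: square_right_quotient_cvg. Qed.

Lemma square_right_derive_right_continuous e : 0 <= e ->
  right_derive C t @[t --> e^'+] --> right_derive C e.
Proof.
move=> e0; rewrite square_right_derive//.
have : 2 * t * D (t ^+ 2) @[t --> e^'+] --> 2 * e * D (e ^+ 2).
  apply: (@cvgM _ R).
    apply: (@cvgM _ R); first exact: cvg_cst.
    by apply: cvg_within_filter; exact: cvg_id.
  exact: cvg_comp (sqr_at_right e0) (D_rc (sqr_ge0 e)).
apply: cvg_trans; apply: near_eq_cvg.
have : \forall t \near e^'+, e < t by exact: nbhs_right_gt.
by apply: filterS => t et; rewrite square_right_derive// (le_trans e0)// ltW.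
Qed.

End square_reparametrization.

(** * Limits of curves of almost minimal energy *)

Section schrodinger.
Context {R : realType} {X : metricType R} (sigma : topology_on X).
Variable E : X -> \bar R.
Local Notation mu := (@lebesgue_measure R).
Hypothesis bounded_subseq : forall u : nat -> X, metric_bounded (range u) ->
  exists phi : nat -> nat, exists l : X,
    increasing_seq phi /\ cvg_in sigma (u \o phi) l.
Hypothesis mdist_lsc : forall (u v : nat -> X) x y,
  cvg_in sigma u x -> cvg_in sigma v y ->
  ((mdist x y)%:E <= limn_einf (fun n => (mdist (u n) (v n))%:E))%E.
Hypothesis slope_sigma_lsc : forall (u : nat -> X) x, cvg_in sigma u x ->
  (slope E x <= limn_einf (fun n => slope E (u n)))%E.

Lemma action_ge0 (g : R -> X) : (0 <= action g)%E.
Proof.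
rewrite /action; case: ifP => // _; rewrite mule_ge0//.
by apply: integral_ge0 => t _; rewrite lee_fin sqr_ge0.
Qed.

Lemma fisher_ge0 (g : R -> X) : (0 <= fisher E g)%E.
Proof.
rewrite /fisher mule_ge0//.
by apply: integral_ge0 => t _; rewrite expe2 mule_ge0// slope_ge0.
Qed.

Lemma abs_cont_curves (g : R -> X) : abs_cont 0 1 g -> curves (g 0) (g 1) g.
Proof.
move=> /abs_cont_dominates_speed[h hg]; split => //.
by apply: clamp_continuous_within; exact: dominates_speed_continuous hg.
Qed.

Lemma finite_action_AC2 (g : R -> X) : (action g < +oo)%E -> AC2 g.
Proof.
move=> gfin; have acg := finite_action_abs_cont gfin; split => //.
move: gfin; rewrite /action asboolT//.
apply: contraTT; rewrite -!leNgt !leye_eq => /eqP ->.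
by rewrite mulry gtr0_sg ?mul1e// invr_gt0.
Qed.

Lemma AC2_finite_action (g : R -> X) : AC2 g -> (action g < +oo)%E.
Proof.
by move=> [acg gfin]; rewrite /action asboolT// lte_mul_pinfty// lee_fin invr_ge0.
Qed.

Lemma cvg_subseq (a_ : nat -> R) (a : R) (phi : nat -> nat) : increasing_seq phi ->
  a_ n @[n --> \oo] --> a -> a_ (phi n) @[n --> \oo] --> a.
Proof.
move=> iphi aa A /aa [N _ NA]; exists N => // n /= Nn; apply: NA => /=.
exact: leq_trans Nn (increasing_seq_ge iphi n).
Qed.

(** The convergence of the actions bounds them, so that a limit curve exists; the
    two lower semicontinuity results and the closedness of the end points apply
    to it. *)
Lemma curve_compactness (gam : nat -> R -> X) (x y : X) (a b : R) (a_ b_ : nat -> R) :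
  (forall n, gam n 0 = x) -> (forall n, gam n 1 = y) ->
  (forall n, (action (gam n) <= (a_ n)%:E)%E) -> a_ n @[n --> \oo] --> a ->
  (forall n, (fisher E (gam n) <= (b_ n)%:E)%E) -> b_ n @[n --> \oo] --> b ->
  exists w, [/\ [/\ AC2 w, w 0 = x & w 1 = y],
    (action w <= a%:E)%E, (fisher E w <= b%:E)%E &
    exists2 phi : nat -> nat, increasing_seq phi & forall t, 0 <= t <= 1 ->
      cvg_in sigma (fun n => gam (phi n) t) (w t)].
Proof.
move=> gx gy ga aa gb bb.
have [A aA] : exists A, forall n, a_ n <= A.
  have [M [_ MP]] := cvg_seq_bounded (cvgP _ aa).
  exists (M + 1) => n; apply: le_trans (ler_norm _) _.
  by apply: MP => //; rewrite ltrDl.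
have gA n : (action (gam n) <= A%:E)%E by rewrite (le_trans (ga n))// lee_fin.
have [phi iphi [w wP]] := limit_curve bounded_subseq mdist_lsc gA gx.
have gw t : 0 <= t <= 1 -> cvg_in sigma (fun n => gam (phi n) t) (w t).
  by move=> t01; have := wP t; rewrite clamp_id.
have [h hw hsq] := action_lsc mdist_lsc (fun n => ga (phi n)) (cvg_subseq iphi aa) gw.
have wa : (action w <= a%:E)%E.
  apply: (le_trans (dominates_speed_action hw)).
  by rewrite lee_pdivrMl.
have endpoint t z : 0 <= t <= 1 -> (forall n, gam n t = z) -> w t = z.
  move=> t01 gz; apply: mdist_positivity; apply/eqP.
  rewrite eq_le mdist_ge0 andbT.
  apply: (mdist_limit_le mdist_lsc (gw t t01) (@cvg_in_cst _ sigma z)) => n /=.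
  by rewrite gz mdistxx.
exists w; split => //.
- split; first by apply: finite_action_AC2; exact: le_lt_trans wa (ltry _).
  + by apply: endpoint; rewrite // lexx ler01.
  + by apply: endpoint; rewrite // lexx ler01.
- apply: (fisher_lsc bounded_subseq mdist_lsc slope_sigma_lsc
    (fun n => gb (phi n)) (cvg_subseq iphi bb)) => // n.
  have acg : abs_cont 0 1 (gam (phi n)).
    by apply: finite_action_abs_cont; exact: le_lt_trans (ga _) (ltry _).
  have [k kg] := abs_cont_dominates_speed acg.
  exact: dominates_speed_continuous kg.
- by exists phi.
Qed.

Variables (x y : X) (w0 : R -> X).
Hypothesis w0_min : minimizers E 0 x y w0.
Hypothesis w0_fisher : (fisher E w0 < +oo)%E.

Let C (eps : R) := fine (cost E eps x y).
Let G (s : R) := C (Num.sqrt s).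

(** The cost of parameter [eps] is the infimum of [p.1 + eps ^+ 2 * p.2] over these
    pairs. For [eps = 0] this uses a minimizer of the action with finite Fisher
    information, since curves of infinite Fisher information also compete for
    the action. *)
Definition energy_pairs : set (R * R) := [set p | exists g,
  [/\ curves x y g, action g = p.1%:E & fisher E g = p.2%:E]].
Let L := fine (fisher E w0).

Lemma AC2_curves g : AC2 g -> g 0 = x -> g 1 = y -> curves x y g.
Proof. by move=> [acg _] <- <-; exact: abs_cont_curves. Qed.

Lemma cost_ge0 eps : (0 <= cost E eps x y)%E.
Proof.
apply: le_ereal_inf_tmp => _ [g _ <-].
by apply: adde_ge0; [exact: action_ge0|rewrite mule_ge0 ?fisher_ge0// lee_fin sqr_ge0].
Qed.

Lemma cost_le eps g : curves x y g -> (cost E eps x y <= action_eps E eps g)%E.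
Proof. by move=> xyg; apply: ereal_inf_lbound; exists g. Qed.

Let w0_curve : curves x y w0.
Proof. by have [? ? ? _] := w0_min; exact: AC2_curves. Qed.

Let w0_action_fin : action w0 \is a fin_num.
Proof.
by rewrite ge0_fin_numE ?action_ge0//; have [? _ _ _] := w0_min; exact: AC2_finite_action.
Qed.

Let w0_fisher_fin : fisher E w0 \is a fin_num.
Proof. by rewrite ge0_fin_numE ?fisher_ge0. Qed.

Let w0_pair : energy_pairs (fine (action w0), L).
Proof. by exists w0; split; rewrite //= fineK. Qed.

Lemma cost_fin_num eps : cost E eps x y \is a fin_num.
Proof.
rewrite ge0_fin_numE ?cost_ge0//; apply: le_lt_trans (cost_le eps w0_curve) _.
by rewrite /action_eps -(fineK w0_action_fin) -(fineK w0_fisher_fin) -EFinM -EFinD ltry.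
Qed.

Lemma costE eps : (C eps)%:E = cost E eps x y.
Proof. by rewrite fineK// cost_fin_num. Qed.

Lemma C_le eps p : energy_pairs p -> C eps <= p.1 + eps ^+ 2 * p.2.
Proof.
move=> [g [xyg ga gb]]; rewrite -lee_fin costE (le_trans (cost_le eps xyg))//.
by rewrite /action_eps ga gb -EFinM -EFinD.
Qed.

Lemma C0E : C 0 = fine (action w0).
Proof. by rewrite /C; have [_ _ _ <-] := w0_min; rewrite action_eps0. Qed.

Lemma CE eps : 0 <= eps -> C eps = G (eps ^+ 2).
Proof. by move=> e0; rewrite /G sqrtr_sqr ger0_norm. Qed.

Lemma G0E : G 0 = C 0. Proof. by rewrite /G sqrtr0. Qed.

Lemma energy_pairs_ge0 p : energy_pairs p -> 0 <= p.2.
Proof. by move=> [g [_ _ gb]]; rewrite -lee_fin -gb fisher_ge0. Qed.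

Lemma G_le p s : energy_pairs p -> 0 <= s -> G s <= p.1 + s * p.2.
Proof. by move=> Qp s0; have := C_le (Num.sqrt s) Qp; rewrite sqr_sqrtr. Qed.

(** For [eps > 0] a finite energy forces both of its terms to be finite. *)
Lemma energy_pair_of eps g (c : R) : 0 < eps -> curves x y g ->
  (action_eps E eps g <= c%:E)%E ->
  exists p, [/\ energy_pairs p, action g = p.1%:E, fisher E g = p.2%:E &
    p.1 + eps ^+ 2 * p.2 <= c].
Proof.
move=> e0 xyg gc.
have e20 : 0 < eps ^+ 2 by rewrite exprn_gt0.
have gfin : (action_eps E eps g < +oo)%E by apply: le_lt_trans gc _; exact: ltry.
have F0 : (0 <= (eps ^+ 2)%:E * fisher E g)%E.
  by rewrite mule_ge0 ?fisher_ge0// lee_fin ltW.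
have Afin : action g \is a fin_num.
  rewrite ge0_fin_numE ?action_ge0//; apply: le_lt_trans gfin.
  by rewrite leeDl.
have Ffin : fisher E g \is a fin_num.
  rewrite (ge0_fin_numE (fisher_ge0 g)).
  have : ((eps ^+ 2)%:E * fisher E g < +oo)%E.
    by apply: le_lt_trans gfin; rewrite leeDr// action_ge0.
  apply: contraTT; rewrite -!leNgt !leye_eq => /eqP ->.
  by rewrite gt0_muley// lte_fin.
exists (fine (action g), fine (fisher E g)); rewrite [(_, _).1]/= [(_, _).2]/=.
have aE := fineK Afin; have fE := fineK Ffin.
split; [|exact/esym|exact/esym|].
  by exists g; split; [exact: xyg|exact/esym|exact/esym].
by rewrite -lee_fin EFinD EFinM aE fE; exact: gc.
Qed.

Lemma G_inf s e : 0 <= s -> 0 < e ->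
  exists2 p, energy_pairs p & p.1 + s * p.2 < G s + e.
Proof.
rewrite le_eqVlt => /predU1P[<-|s0] e0.
  exists (fine (action w0), L) => //=.
  by rewrite mul0r addr0 G0E C0E ltrDl.
have ss0 : 0 < Num.sqrt s by rewrite sqrtr_gt0.
have : (cost E (Num.sqrt s) x y < (G s + e)%:E)%E.
  by rewrite -costE lte_fin ltrDl.
move=> /ereal_inf_lt[_ [g xyg <-] glt].
have efin : action_eps E (Num.sqrt s) g \is a fin_num.
  rewrite ge0_fin_numE; first by apply: lt_trans glt _; exact: ltry.
  exact: le_trans (cost_ge0 _) (cost_le _ xyg).
have [|p [Qp pa pf ple]] := @energy_pair_of (Num.sqrt s) g
  (fine (action_eps E (Num.sqrt s) g)) ss0 xyg.
  by rewrite fineK.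
exists p => //; rewrite sqr_sqrtr ?(ltW s0)// in ple.
by apply: le_lt_trans ple _; rewrite -lte_fin fineK.
Qed.

Lemma G_slope0 s : 0 <= s -> G s <= G 0 + s * L.
Proof. by move=> s0; have := G_le w0_pair s0; rewrite /= G0E C0E. Qed.

Let m := right_slope G 0.

Lemma quotient_le_m s : 0 < s -> G s <= G 0 + s * m.
Proof.
move=> s0.
have := right_quotient_le_right_slope G_le G_inf G_slope0 (lexx 0) s0.
by rewrite /right_quotient add0r ler_pdivrMl// -/m; lra.
Qed.

Lemma G0_le p : energy_pairs p -> G 0 <= p.1.
Proof. by move=> Qp; have := G_le Qp (lexx 0); rewrite mul0r addr0. Qed.

(** The pair of a minimizer of the action bounds [G] by an affine function that
    agrees with it at the origin. *)
Lemma m_le_fisher w : minimizers E 0 x y w -> (m%:E <= fisher E w)%E.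
Proof.
move=> [ac2w w_0 w_1 wmin].
have [fw|] := ltP (fisher E w) +oo%E; last by rewrite leye_eq => /eqP ->; rewrite leey.
have fwfin : fisher E w \is a fin_num by rewrite ge0_fin_numE ?fisher_ge0.
have Qp : energy_pairs (C 0, fine (fisher E w)).
  exists w; split; first exact: AC2_curves.
    by rewrite -(action_eps0 E) wmin -costE.
  by rewrite fineK.
rewrite -(fineK fwfin) lee_fin; apply: ge_sup.
  by exists (right_quotient G 0 1), 1 => /=.
move=> _ [h /= h0 <-]; rewrite /right_quotient add0r ler_pdivrMl//.
by have := G_le Qp (ltW h0); rewrite /= G0E; lra.
Qed.

(** The action of [gam n] is at most [G (s_ n) + s_ n ^+ 2], and at least [G 0],
    which leaves at most [(G (s_ n) - G 0) / s_ n + s_ n <= m + s_ n] for its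
    Fisher information. *)
Lemma energy_limit (gam : nat -> R -> X) (s_ : nat -> R) :
  (forall n, 0 < s_ n) -> s_ n @[n --> \oo] --> 0 ->
  (forall n, exists p, [/\ energy_pairs p, action (gam n) = p.1%:E,
     fisher E (gam n) = p.2%:E & p.1 + s_ n * p.2 <= G (s_ n) + s_ n ^+ 2]) ->
  (forall n, gam n 0 = x) -> (forall n, gam n 1 = y) ->
  exists w, [/\ minimizers E 0 x y w, fisher E w = m%:E &
    exists2 phi : nat -> nat, increasing_seq phi & forall t, 0 <= t <= 1 ->
      cvg_in sigma (fun n => gam (phi n) t) (w t)].
Proof.
move=> s0 s_0 gamP gx gy.
have lim_a : G 0 + s_ n * m + s_ n ^+ 2 @[n --> \oo] --> G 0.
  rewrite [X in _ --> X](_ : _ = G 0 + 0 * m + 0 * 0); last by ring.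
  apply: (@cvgD _ R); last exact: (cvgM s_0 s_0).
  by apply: (@cvgD _ R); [exact: cvg_cst|exact: (cvgM s_0 (cvg_cst _))].
have lim_b : m + s_ n @[n --> \oo] --> m.
  by rewrite -[X in _ --> X]addr0; apply: (@cvgD _ R); [exact: cvg_cst|exact: s_0].
have [w [[ac2w w_0 w_1] wa wf [phi iphi gw]]] :
  exists w, [/\ [/\ AC2 w, w 0 = x & w 1 = y],
    (action w <= (G 0)%:E)%E, (fisher E w <= m%:E)%E &
    exists2 phi : nat -> nat, increasing_seq phi & forall t, 0 <= t <= 1 ->
      cvg_in sigma (fun n => gam (phi n) t) (w t)].
  apply: (curve_compactness gx gy _ lim_a _ lim_b) => n.
    have [p [Qp -> _ ple]] := gamP n; rewrite lee_fin.
    have := quotient_le_m (s0 n).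
    have := mulr_ge0 (ltW (s0 n)) (energy_pairs_ge0 Qp); move: ple; lra.
  have [p [Qp _ -> ple]] := gamP n; rewrite lee_fin.
  have := quotient_le_m (s0 n); have := G0_le Qp.
  rewrite -(ler_pM2l (s0 n)); move: ple; rewrite expr2; lra.
have wmin : minimizers E 0 x y w.
  split => //; apply/eqP; rewrite eq_le; apply/andP; split.
    by rewrite action_eps0 -costE -G0E.
  exact/cost_le/AC2_curves.
exists w; split => //; last by exists phi.
by apply/eqP; rewrite eq_le wf m_le_fisher.
Qed.

(** By definition of the infimum there are curves that minimize up to [s ^+ 2], and
    the previous lemma applies to them along [s = 1 / n.+1]. *)
Lemma exists_minimal_fisher : exists2 w, minimizers E 0 x y w & fisher E w = m%:E.
Proof.
pose s_ n : R := n.+1%:R^-1.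
have s0 n : 0 < s_ n by rewrite invr_gt0.
have near_opt n : exists g p, [/\ energy_pairs p, action g = p.1%:E,
     fisher E g = p.2%:E & p.1 + s_ n * p.2 <= G (s_ n) + s_ n ^+ 2] /\
     (g 0 = x /\ g 1 = y).
  have [|p Qp ple] := @G_inf (s_ n) (s_ n ^+ 2) (ltW (s0 n)); first exact: exprn_gt0.
  have [g [[_ gx gy] ga gf]] := Qp; exists g, p; do !split => //; exact: ltW.
have /(_ _)/cid-/all_sig[gam gamP] := near_opt.
have [w [wmin wf _]] := @energy_limit gam s_ s0 (@cvg_harmonic R)
  (fun n => let: ex_intro p (conj H _) := gamP n in ex_intro _ p H)
  (fun n => let: ex_intro p (conj _ (conj H _)) := gamP n in H)
  (fun n => let: ex_intro p (conj _ (conj _ H)) := gamP n in H).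
by exists w.
Qed.

End schrodinger.

(** * Small-noise limit of the cost and of its minimizers *)

Theorem theorem5p8 (R : realType) (X : metricType R) (E : X -> \bar R)
    (sigma : topology_on X) (x y : X)
    (E_ninfty : forall z, E z <> -oo%E)
    (A1 : assumption_A1 X) (A2 : assumption_A2 E) (A3 : assumption_A3 E)
    (AS : assumption_S E sigma)
    (solvable : exists2 eps : R, 0 < eps & schrodinger_solvable E eps x y)
    (omega0 : exists2 w, minimizers E 0 x y w & (fisher E w < +oo)%E) :
  let C := fun eps : R => fine (cost E eps x y) in
  [/\ forall eps : R, 0 <= eps -> cost E eps x y \is a fin_num,
      right_derivable C 0 /\ right_derive C 0 = 0,
      (forall eps : R, 0 < eps -> right_derivable C eps) /\
      (forall eps : R, 0 <= eps ->
         right_derive C e @[e --> eps^'+] --> right_derive C eps),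
      exists2 m : R,
        ereal_inf [set fisher E w | w in minimizers E 0 x y] = m%:E &
        (fun eps => C eps - C 0) =
          (fun eps => eps ^+ 2 * m) +o_ (0^'+) (fun eps => eps ^+ 2) &
      forall (eps_ : nat -> R) (omega : nat -> R -> X),
        (forall n, 0 < eps_ n) -> eps_ n @[n --> \oo] --> 0 ->
        (forall n, minimizers E (eps_ n) x y (omega n)) ->
        exists2 omega_ : R -> X, minimizers E 0 x y omega_ &
          (exists2 phi : nat -> nat, increasing_seq phi &
             forall t, 0 <= t <= 1 ->
               cvg_in sigma (fun n => omega (phi n) t) (omega_ t)) /\
          (forall w, minimizers E 0 x y w ->
             (fisher E omega_ <= fisher E w)%E)].
Proof.
move=> C; have [w0 w0_min w0_fisher] := omega0.
have [_ bounded_subseq mdist_lsc slope_lsc] := AS.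
pose G (s : R) := C (Num.sqrt s).
pose D := right_slope G.
have Q0 := @energy_pairs_ge0 R X E x y.
have GQ : forall p s, energy_pairs E x y p -> 0 <= s -> G s <= p.1 + s * p.2.
  exact: G_le w0_min w0_fisher.
have Ginf : forall s e, 0 <= s -> 0 < e ->
    exists2 p, energy_pairs E x y p & p.1 + s * p.2 < G s + e.
  exact: G_inf w0_min w0_fisher.
have Gslope := G_slope0 w0_min w0_fisher.
have D_cvg s (s0 : 0 <= s) := right_slope_cvg GQ Ginf Gslope s0.
have D_rc s (s0 : 0 <= s) := right_slope_right_continuous Q0 GQ Ginf Gslope s0.
have CG eps : 0 <= eps -> C eps = G (eps ^+ 2).
  by move=> e0; rewrite /G sqrtr_sqr ger0_norm.
have rd eps : 0 <= eps -> right_derive C eps = 2 * eps * D (eps ^+ 2).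
  exact: (square_right_derive D_cvg CG).
have [wm wm_min wm_fisher] := exists_minimal_fisher bounded_subseq mdist_lsc slope_lsc
  w0_min w0_fisher.
split.
- by move=> eps _; exact: cost_fin_num w0_min w0_fisher _.
- split; first exact: (square_right_derivable D_cvg CG).
  by rewrite rd// mulr0 mul0r.
- split => eps e0; first exact: (square_right_derivable D_cvg CG (ltW e0)).
  exact: (square_right_derive_right_continuous D_cvg D_rc CG e0).
- exists (D 0).
    apply/eqP; rewrite eq_le; apply/andP; split.
      by rewrite -wm_fisher; apply: ereal_inf_lbound; exists wm.
    apply: le_ereal_inf_tmp => _ [w wmin <-].
    exact: (m_le_fisher w0_min w0_fisher wmin).
  apply/eqaddoP => e e0.
  have sq0 : t ^+ 2 @[t --> (0 : R)^'+] --> (0 : R)^'+.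
    by have := sqr_at_right (lexx (0 : R)); rewrite expr0n.
  have Dq : \forall h \near (0 : R)^'+, `|D 0 - h^-1 * (G (0 + h) - G 0)| <= e.
    by have /(@cvgrPdist_le _ R) := D_cvg 0 (lexx 0); apply.
  have t_gt0 : \forall t \near (0 : R)^'+, 0 < t by exact: nbhs_right_gt.
  have := sq0 _ Dq; move: t_gt0; apply: filterS2 => t t0 Dt.
  change (`|C t - C 0 - t ^+ 2 * D 0| <= e * `|t ^+ 2|).
  have t20 : 0 < t ^+ 2 by rewrite exprn_gt0.
  have -> : C t - C 0 - t ^+ 2 * D 0 =
      - (t ^+ 2 * (D 0 - (t ^+ 2)^-1 * (G (0 + t ^+ 2) - G 0))).
    rewrite add0r -(CG _ (ltW t0)) /G sqrtr0; field.
    by rewrite gt_eqF.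
  rewrite normrN normrM (gtr0_norm t20) (mulrC e).
  by apply: ler_wpM2l Dt; exact: ltW.
- move=> eps_ omega eps0 eps_0 omega_min.
  have [|||||w [wmin wf [phi iphi gw]]] := @energy_limit R X sigma E bounded_subseq
    mdist_lsc slope_lsc x y w0 w0_min w0_fisher omega (fun n => eps_ n ^+ 2).
  - by move=> n; rewrite exprn_gt0.
  - by rewrite -(mulr0 (0 : R)); exact: (cvgM eps_0 eps_0).
  - move=> n; have [ac2 o0 o1 omin] := omega_min n.
    have [|p [Qp pa pf ple]] := @energy_pair_of R X E x y (eps_ n) (omega n) (C (eps_ n))
      (eps0 n) (AC2_curves ac2 o0 o1).
      by rewrite (costE w0_min w0_fisher) omin.
    exists p; split => //=; rewrite sqrtr_sqr gtr0_norm//.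
    by apply: (le_trans ple); rewrite lerDl sqr_ge0.
  - by move=> n; have [_ -> _ _] := omega_min n.
  - by move=> n; have [_ _ -> _] := omega_min n.
  exists w; first exact: wmin.
  split; first by exists phi.
  by move=> w' w'min; rewrite wf; exact: (m_le_fisher w0_min w0_fisher w'min).
Qed.
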